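(* Let $A$ be an $n\times n$ dilation matrix. Then there exists a positive integer $\beta\ge 1$ such that for all integers $k\ge\beta$ there exists a multiresolution analysis associated with the dilation matrix $A^k$.
   Context: A dilation matrix (for $\mathbb{Z}^n$) is an $n\times n$ matrix $A$ with integer entries, all of whose eigenvalues $\lambda$ satisfy $|\lambda|>1$. A multiresolution analysis (MRA) associated with a dilation matrix $B$ is a nested sequence of subspaces $\cdots\subset V_{-1}\subset V_0\subset V_1\subset\cdots$ of $L^2(\mathbb{R}^n)$ satisfying: (1) $\overline{\bigcup_{j\in\mathbb{Z}}V_j}=L^2(\mathbb{R}^n)$; (2) $\bigcap_{j\in\mathbb{Z}}V_j=\{0\}$; (3) $f(x)\in V_j$ if and only if $f(Bx)\in V_{j+1}$, for all $j\in\mathbb{Z}$; (4) $f(x)\in V_0$ if and only if $f(x-k)\in V_0$ for all $k\in\mathbb{Z}^n$; and (5) there exists a function $\phi\in V_0$, called a scaling function, such that $\{\phi(x-k):\ k\in\mathbb{Z}^n\}$ is a complete orthonormal basis for $V_0$. *)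

(* Defs.v *)
From HB Require Import structures.
From mathcomp Require Import all_boot all_order all_algebra.
From mathcomp Require Import all_classical all_reals all_analysis.
From mathcomp Require Import complex.

Set Implicit Arguments.
Unset Strict Implicit.
Unset Printing Implicit Defensive.

Import Order.TTheory GRing.Theory Num.Theory.
Import numFieldNormedType.Exports.

Local Open Scope classical_set_scope.
Local Open Scope ring_scope.
Local Open Scope complex_scope.

Definition measure_mx_display : measure_display -> measure_display.
Proof. exact. Qed.

Section measurable_matrix.
Context {d : measure_display} {T : measurableType d}.
Variables m n : nat.

Definition mx_coordinate_sets : set (set 'M[T]_(m, n)) :=
  \bigcup_(ij in [set: 'I_m * 'I_n])
    preimage_set_system setT (fun M : 'M[T]_(m, n) => M ij.1 ij.2) measurable.

Let mx_set0 : <<s mx_coordinate_sets >> set0.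
Proof. exact: sigma_algebra0. Qed.

Let mx_setC A : <<s mx_coordinate_sets >> A -> <<s mx_coordinate_sets >> (~` A).
Proof. exact: sigma_algebraC. Qed.

Let mx_bigcup (F : _^nat) : (forall i, <<s mx_coordinate_sets >> (F i)) ->
  <<s mx_coordinate_sets >> (\bigcup_i (F i)).
Proof. exact: sigma_algebra_bigcup. Qed.

HB.instance Definition _ := @isMeasurable.Build (measure_mx_display d)
  'M[T]_(m, n) <<s mx_coordinate_sets >> mx_set0 mx_setC mx_bigcup.

Lemma measurable_mx_coord i j :
  measurable_fun [set: 'M[T]_(m, n)] (fun M : 'M[T]_(m, n) => M i j).
Proof.
move=> _ Y mY; apply: sub_sigma_algebra; exists (i, j) => //.
by exists Y.
Qed.

Lemma measurable_fun_mxP d1 (T1 : measurableType d1) (f : T1 -> 'M[T]_(m, n)) :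
  measurable_fun setT f <-> forall i j, measurable_fun setT (fun x => f x i j).
Proof.
split=> [mf i j|mf _ Y].
  by apply: (measurableT_comp (measurable_mx_coord i j)).
rewrite setTI; apply: (@smallest_sub _ (sigma_algebra setT) _
  [set Y | measurable (f @^-1` Y)]).
  split=> /=.
  - by rewrite preimage_set0; exact: measurable0.
  - by move=> A mA; rewrite setTD preimage_setC; exact: measurableC.
  - by move=> F mF; rewrite preimage_bigcup; exact: bigcupT_measurable.
move=> A [[i j] _ [B mB <-]] /=; rewrite setTI.
by have := mf i j measurableT B mB; rewrite setTI.
Qed.

End measurable_matrix.

Section lebesgue_measure_Rn.
Context {R : realType}.

Definition cV_cons n (x : measurableTypeR R * 'cV[R]_n) : 'cV[R]_n.+1 :=
  col_mx (x.1 : R)%:M x.2.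

Definition cV_uncons n (v : 'cV[R]_n.+1) : measurableTypeR R * 'cV[R]_n :=
  (v ord0 ord0, \col_i v (lift ord0 i) ord0).

Lemma cV_cons0 n x : @cV_cons n x ord0 ord0 = x.1.
Proof.
rewrite /cV_cons (_ : ord0 = lshift n (ord0 : 'I_1)); last exact: val_inj.
by rewrite (@col_mxEu _ 1 n 1) mxE eqxx mulr1n.
Qed.

Lemma cV_consS n x i : @cV_cons n x (lift ord0 i) ord0 = x.2 i ord0.
Proof.
rewrite /cV_cons (_ : lift ord0 i = rshift 1 i); last exact: val_inj.
by rewrite (@col_mxEd _ 1 n 1).
Qed.

Lemma cV_consK n : cancel (@cV_cons n) (@cV_uncons n).
Proof.
move=> [a v]; congr pair; first by rewrite cV_cons0.
by apply/colP => i; rewrite mxE cV_consS.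
Qed.

Lemma cV_unconsK n : cancel (@cV_uncons n) (@cV_cons n).
Proof.
move=> v; apply/colP => i.
have [<-|/unlift_some[j -> _]] := eqVneq ord0 i; first by rewrite cV_cons0.
by rewrite cV_consS mxE.
Qed.

Lemma measurable_cV_cons n : measurable_fun setT (@cV_cons n).
Proof.
apply/measurable_fun_mxP => i j; rewrite (ord1 j).
have [<-|/unlift_some[k -> _]] := eqVneq ord0 i.
  by under eq_fun do rewrite cV_cons0; exact: measurable_fst.
under eq_fun do rewrite cV_consS.
exact: (measurableT_comp (measurable_mx_coord k ord0) measurable_snd).
Qed.

Lemma measurable_cV_uncons n : measurable_fun setT (@cV_uncons n).
Proof.
apply/measurable_fun_pairP; split; first exact: measurable_mx_coord.
apply/measurable_fun_mxP => i j; rewrite /=.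
under eq_fun do rewrite mxE; exact: measurable_mx_coord.
Qed.

Section step.
Variables (n : nat) (mu : {sigma_finite_measure set 'cV[R]_n -> \bar R}).

Definition lebesgue_step : set 'cV[R]_n.+1 -> \bar R :=
  pushforward (@lebesgue_measure R \x mu)%E (@cV_cons n).

HB.instance Definition _ := Measure.copy lebesgue_step
  (@measure_function_pushforward__canonical__measure_function_Measure
     _ _ _ _ _ (@lebesgue_measure R \x mu)%E _ (@measurable_cV_cons n)).

Let lebesgue_step_sigma_finite : sigma_finite setT lebesgue_step.
Proof.
have /sigma_finiteP[F [TF ndF Foo]] := sigma_finiteT (@lebesgue_measure R).
have /sigma_finiteP[G [TG ndG Goo]] := sigma_finiteT mu.
exists (fun k => @cV_uncons n @^-1` (F k `*` G k)).
  apply/esym; rewrite -subTset => v _.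
  have : setT (v ord0 ord0) by [].
  rewrite TF => -[k _ Fk].
  have : setT (cV_uncons v).2 by [].
  rewrite TG => -[l _ Gl].
  exists (maxn k l) => //; split.
  - exact: (subsetPset _ _ (ndF _ _ (leq_maxl k l))).
  - exact: (subsetPset _ _ (ndG _ _ (leq_maxr k l))).
move=> k; have [mF Fk] := Foo k; have [mG Gk] := Goo k; split.
  rewrite -[X in measurable X]setTI; apply: measurable_cV_uncons => //.
  exact: measurableX.
rewrite /lebesgue_step /pushforward -comp_preimage.
rewrite (_ : _ \o _ = id); last exact/funext/cV_consK.
by rewrite preimage_id product_measure1E// lte_mul_pinfty// ge0_fin_numE.
Qed.

HB.instance Definition _ := @Measure_isSigmaFinite.Build _ _ _
  lebesgue_step lebesgue_step_sigma_finite.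

End step.

(* Lebesgue measure on the Borel sets of R^n: the n-fold product of the
   Lebesgue measure of R (for n = 0, the unit mass of the one-point space). *)
Fixpoint lebesgue_cV n : {sigma_finite_measure set 'cV[R]_n -> \bar R} :=
  if n is n'.+1 then lebesgue_step (lebesgue_cV n')
  else dirac (0 : 'cV[R]_0).

Lemma lebesgue_cV_box n (A : 'I_n -> set R) : (forall i, measurable (A i)) ->
  (lebesgue_cV n [set v : 'cV[R]_n | forall i, A i (v i ord0)] =
   \prod_(i < n) @lebesgue_measure R (A i))%E.
Proof.
elim: n A => [A _|n IH A mA].
  by rewrite big_ord0 /= diracE mem_set//= => -[].
rewrite big_ord_recl -IH//= /lebesgue_step /pushforward.
rewrite -product_measure1E//; last first.
  rewrite (_ : [set v | _] = \bigcap_(i in [set: 'I_n])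
    ((fun v : 'cV[R]_n => v i ord0) @^-1` A (lift ord0 i))).
    apply: fin_bigcap_measurable => [|i _]; first exact: finite_finset.
    by rewrite -[X in measurable X]setTI; exact: measurable_mx_coord.
  by apply/seteqP; split => v /= vA i; [move=> _|]; exact: vA.
  exact: mA.
congr (_ \x _)%E; apply/seteqP; split => -[a v] /= vA.
  split; first by have := vA ord0; rewrite cV_cons0.
  by move=> i; have := vA (lift ord0 i); rewrite cV_consS.
case: vA => aA vA i.
have [<-|/unlift_some[k -> _]] := eqVneq ord0 i; first by rewrite cV_cons0.
by rewrite cV_consS.
Qed.

End lebesgue_measure_Rn.

Section square_integrable.
Context {R : realType} {n : nat}.
Implicit Types (f g : 'cV[R]_n -> R[i]) (S : set ('cV[R]_n -> R[i])).

Definition measurable_Cfun f :=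
  measurable_fun setT (fun x => complex.Re (f x)) /\
  measurable_fun setT (fun x => complex.Im (f x)).

(* The modulus `|z| lives in R[i]; its real part is the modulus as an element
   of R. *)
Definition L2norm f : \bar R :=
  'N[lebesgue_cV n]_2%:E[EFin \o (fun x => complex.Re `|f x|)].

(* Elements of L^2 are handled through representatives: a subset of L^2(R^n)
   is a set of square-integrable functions that is closed under almost
   everywhere equality. *)
Definition L2 : set ('cV[R]_n -> R[i]) :=
  [set f | measurable_Cfun f /\ (L2norm f < +oo)%E].

Definition ae_equal f g := {ae lebesgue_cV n, forall x, f x = g x}.

Definition inner f g : R[i] :=
  let h x := f x * (g x)^* in
  Complex (\int[lebesgue_cV n]_x complex.Re (h x))
          (\int[lebesgue_cV n]_x complex.Im (h x)).

Definition L2closure S : set ('cV[R]_n -> R[i]) :=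
  [set f | L2 f /\ forall e : R, 0 < e ->
     exists2 g, S g & (L2norm (fun x => f x - g x)%R < e%:E)%E].

Record L2subspace S : Prop := {
  L2subspace_sub : S `<=` L2;
  L2subspace_ae : forall f g, S f -> L2 g -> ae_equal f g -> S g;
  L2subspace0 : S (fun=> 0);
  L2subspace_lin : forall (c : R[i]) f g,
    S f -> S g -> S (fun x => c * f x + g x) }.

Definition lin_span (I : choiceType) (e : I -> 'cV[R]_n -> R[i]) :
    set ('cV[R]_n -> R[i]) :=
  [set f | exists (s : seq I) (c : I -> R[i]),
     f = fun x => \sum_(k <- s) c k * e k x].

(* The last clause makes S the closed linear span of e; in particular a space
   with an orthonormal basis is closed in L^2. *)
Record orthonormal_basis (I : choiceType) (e : I -> 'cV[R]_n -> R[i]) S :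
    Prop := {
  orthonormal_basis_mem : forall k, S (e k);
  orthonormal_basis_inner : forall k l, inner (e k) (e l) = (k == l)%:R;
  orthonormal_basis_complete : S = L2closure (lin_span e) }.

End square_integrable.

Definition int_mx (K : pzRingType) m n (B : 'M[int]_(m, n)) : 'M[K]_(m, n) :=
  map_mx intr B.

Definition dilation_matrix (R : realType) n (A : 'M[int]_n) : Prop :=
  forall z : R[i], eigenvalue (int_mx R[i] A) z -> 1 < `|z|.

Definition dilate (R : realType) n (B : 'M[int]_n) (f : 'cV[R]_n -> R[i]) :=
  fun x : 'cV[R]_n => f (int_mx R B *m x).

Definition translate (R : realType) n (k : 'cV[int]_n)
    (f : 'cV[R]_n -> R[i]) :=
  fun x : 'cV[R]_n => f (x - int_mx R k).

Record multiresolution_analysis (R : realType) n (B : 'M[int]_n)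
    (V : int -> set ('cV[R]_n -> R[i])) : Prop := {
  mra_matrix : dilation_matrix R B;
  mra_subspace : forall j, L2subspace (V j);
  mra_nested : forall j, V j `<=` V (j + 1);
  mra_union : L2closure (\bigcup_j V j) = L2;
  mra_bigcap : \bigcap_j V j = [set f | L2 f /\ ae_equal f (fun=> 0)];
  mra_dilate : forall j f, L2 f -> (V j f <-> V (j + 1) (dilate B f));
  mra_translate : forall k f, L2 f -> (V 0 f <-> V 0 (translate k f));
  mra_scaling : exists2 phi, V 0 phi &
    orthonormal_basis (fun k : 'cV[int]_n => translate k phi) (V 0) }.

(* Main.v *)
Require Import Defs.
From HB Require Import structures.
From mathcomp Require Import all_boot all_order all_algebra.
From mathcomp Require Import all_classical all_reals all_analysis.
From mathcomp Require Import measurable_realfun complex ring lra zify.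

Set Implicit Arguments.
Unset Strict Implicit.
Unset Printing Implicit Defensive.

Import Order.TTheory GRing.Theory Num.Theory.
Import numFieldNormedType.Exports.

Local Open Scope classical_set_scope.
Local Open Scope ring_scope.

(** The multiresolution analysis is of Haar type: the scaling function is the
    indicator of a self-affine tile.

    Put B = A^k.  Since the eigenvalues of the inverse of A lie inside the unit
    disc, its powers tend to 0 (Cayley-Hamilton, [cvg_contracting_power]), so
    for k large N = B^-1 contracts the sup norm by a factor 1/4
    ([dilation_power_contracting]).  Let Q be the half-open unit cube centred
    at 0, whose integer translates tile the space, and let the digits be the
    integer vectors of BQ; they represent Z^n modulo B Z^n exactly once.  The
    tile T is the compact set of the sums of N^j d_j over j >= 1 with digits
    d_j; it satisfies BT = T + digits ([tile_refine]), and its integer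
    translates cover the space ([tile_cover]).

    The point is that T has measure 1, that is, that distinct integer
    translates of T overlap in a null set.  Because N contracts by less than
    1/2, repeated division with remainder by B shrinks every integer vector to
    0: each integer vector is a finite sum of terms B^j d_j
    ([digit_expansions_exhaust]).  Hence for each k there is an m such that
    T and T + k are among the (number of digits)^m translates whose union
    contains B^m T.  The measure of B^m T is delta^m times that of T, where
    delta is the measure of BQ, and delta is at least the number of digits
    ([size_digits_le]), so there is no room for an overlap
    ([tile_overlap0]).

    Let V_j be the space of the square-integrable functions that are a.e.
    constant on each cell B^-j (T + k).  Refinement of cells gives nestedness.
    A function in V_(-m) has values of squared modulus at most 2^-m times its
    squared norm, because its cells have measure at least 2^m, so the
    intersection is trivial.  The cells of V_m have diameter tending to 0, so
    that every bounded open set is the increasing limit of the unions of the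
    cells that it contains; with a Dynkin argument and simple functions this
    makes the union dense ([L2closed_dense], [tile_mra_dense]).  The integer
    translates of the indicator of T form an orthonormal basis of V_0.

    The determinant of B never appears: the scaling of Lebesgue measure by
    a linear map is obtained from translation invariance and Fubini's theorem
    ([lebesgue_linear]), and measures of tilings are compared with
    [lebesgue_packing].  The norm enters through its square, [energy], for
    which the inequality |z + w|^2 <= 2 (|z|^2 + |w|^2) replaces the triangle
    inequality. *)

(** * Measurable maps and translation invariance *)

Section measurable_maps.
Context {R : realType}.
Implicit Types n : nat.

Lemma measurable_mulmx m n (P : 'M[R]_(m, n)) :
  measurable_fun setT (fun x : 'cV[R]_n => P *m x).
Proof.
apply/measurable_fun_mxP => i j; rewrite (ord1 j).
under eq_fun do rewrite mxE.
apply: measurable_sum => k.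
by apply: measurable_funM => //; exact: measurable_mx_coord.
Qed.

Lemma measurable_mxD d (T : measurableType d) n (f g : T -> 'cV[R]_n) :
  measurable_fun setT f -> measurable_fun setT g ->
  measurable_fun setT (fun x => f x + g x).
Proof.
move=> /measurable_fun_mxP mf /measurable_fun_mxP mg.
apply/measurable_fun_mxP => i j; under eq_fun do rewrite mxE.
exact: measurable_funD.
Qed.

Lemma measurable_mxN d (T : measurableType d) n (f : T -> 'cV[R]_n) :
  measurable_fun setT f -> measurable_fun setT (fun x => - f x).
Proof.
move=> /measurable_fun_mxP mf.
apply/measurable_fun_mxP => i j; under eq_fun do rewrite mxE.
exact: measurableT_comp.
Qed.

Lemma measurable_mxB d (T : measurableType d) n (f g : T -> 'cV[R]_n) :
  measurable_fun setT f -> measurable_fun setT g ->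
  measurable_fun setT (fun x => f x - g x).
Proof. by move=> mf mg; apply: measurable_mxD => //; exact: measurable_mxN. Qed.

Lemma measurable_affine n (P : 'M[R]_n) (t : 'cV[R]_n) :
  measurable_fun setT (fun x : 'cV[R]_n => P *m x + t).
Proof. by apply: measurable_mxD => //; exact: measurable_mulmx. Qed.

Lemma measurable_trans n (t : 'cV[R]_n) :
  measurable_fun setT (fun x : 'cV[R]_n => x + t).
Proof. exact: measurable_mxD. Qed.

Lemma measurable_setT_preimage d1 d2 (T1 : measurableType d1)
    (T2 : measurableType d2) (f : T1 -> T2) (E : set T2) :
  measurable_fun setT f -> measurable E -> measurable [set x | E (f x)].
Proof. by move=> mf mE; rewrite -[X in measurable X]setTI; exact: mf. Qed.

End measurable_maps.

Section translation.
Context {R : realType}.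

Lemma lebesgue_measure_translate (t : R) (A : set (measurableTypeR R)) :
  measurable A -> @lebesgue_measure R [set x | A (x + t)] = lebesgue_measure A.
Proof.
move=> mA.
have mt : measurable_fun setT
    ((fun x => x + t) : measurableTypeR R -> measurableTypeR R).
  exact: measurable_funD.
pose mu := pushforward (@lebesgue_measure R)
    ((fun x => x + t) : measurableTypeR R -> measurableTypeR R).
pose mm : {measure set (measurableTypeR R) -> \bar R} :=
  @measure_function_pushforward__canonical__measure_function_Measure
     _ _ _ _ _ (@lebesgue_measure R) _ mt.
change (mm A = lebesgue_measure A); apply/esym.
apply: lebesgue_measure_unique => // X [-[a b] _ <-].
change (lebesgue_measure (`]a, b]%classic : set (measurableTypeR R)) =
  mu `]a, b]%classic).
rewrite /mu /pushforward (_ : _ @^-1` _ = [set` `](a - t), (b - t)] ]).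
  rewrite !lebesgue_measure_itv/= !lte_fin ltrD2r; case: ifP => // _.
  by rewrite -!EFinD; congr EFin; ring.
by apply/seteqP; split => x /=; rewrite !in_itv /= ltrBlDr lerBrDr.
Qed.

(** By induction on the dimension: a section of the translated set is a
    translate of a section, so the claim reduces to the line. *)
Lemma lebesgue_cV_translate n (t : 'cV[R]_n) (E : set 'cV[R]_n) :
  measurable E -> lebesgue_cV n [set x | E (x + t)] = lebesgue_cV n E.
Proof.
elim: n t E => [t E mE|n IH t E mE].
  by congr (lebesgue_cV 0 _); apply/seteqP; split => x /=;
    rewrite (_ : x + t = x)//; apply/colP => -[].
rewrite /= /lebesgue_step /pushforward /product_measure1.
pose t0 := t ord0 ord0; pose t' : 'cV[R]_n := \col_i t (lift ord0 i) ord0.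
pose E' := @cV_cons R n @^-1` E.
have mE' : measurable E'.
  by apply: measurable_setT_preimage => //; exact: measurable_cV_cons.
pose g x := lebesgue_cV n (xsection E' x).
have mg : measurable_fun setT g by exact: measurable_fun_xsection.
transitivity (\int[@lebesgue_measure R]_x g (x + t0)%R)%E.
  apply: eq_integral => x _ /=.
  rewrite /g -[RHS](IH t'); last exact: measurable_xsection.
  congr (lebesgue_cV n _); apply/seteqP; split => y /=;
    rewrite /xsection /= !inE /E' /=;
    rewrite (_ : cV_cons (x + t0, y + t') = cV_cons (x, y) + t)//;
    apply/colP => i; rewrite [RHS]mxE;
    (have [<-|/unlift_some[k -> _]] := eqVneq ord0 i;
      [by rewrite !cV_cons0 | by rewrite !cV_consS !mxE]).
have mt : measurable_fun setT
    ((fun x => x + t0) : measurableTypeR R -> measurableTypeR R).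
  exact: measurable_funD.
transitivity (\int[pushforward (@lebesgue_measure R)
    ((fun x => (x + t0)%R) : measurableTypeR R -> measurableTypeR R)]_x g x)%E.
  rewrite ge0_integral_pushforward ?preimage_setT//.
apply: eq_measure_integral => A mA _.
by rewrite /pushforward; exact: lebesgue_measure_translate.
Qed.

End translation.

(** * Scaling of Lebesgue measure by a linear map, and packings *)
Section scaling.
Context {R : realType} {n : nat}.
Notation la := (lebesgue_cV n).
Implicit Types (E F : set 'cV[R]_n).

Definition half_open_cube : set 'cV[R]_n :=
  [set x | forall i, - (1 / 2) <= x i ord0 < 1 / 2].

Lemma measurable_half_open_cube : measurable half_open_cube.
Proof.
rewrite (_ : half_open_cube = \bigcap_(i in [set: 'I_n])
    ((fun v : 'cV[R]_n => v i ord0) @^-1` `[- (1 / 2), 1 / 2[)).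
  apply: fin_bigcap_measurable => [|i _]; first exact: finite_finset.
  by apply: measurable_setT_preimage => //; exact: measurable_mx_coord.
by apply/seteqP; split=> x h i => [_|]; have := h i; rewrite /= in_itv/=; exact.
Qed.

Lemma lebesgue_half_open_cube : la half_open_cube = 1%E.
Proof.
have -> : half_open_cube = [set v : 'cV[R]_n |
    forall i, `[- (1 / 2), 1 / 2[%classic (v i ord0)].
  by apply/seteqP; split=> x h i; have := h i; rewrite /= in_itv.
rewrite (@lebesgue_cV_box R n (fun=> `[- (1 / 2), 1 / 2[%classic)) => [|i]; last first.
  exact: measurable_itv.
rewrite big1// => i _; rewrite lebesgue_measure_itv/= lte_fin ifT; last lra.
by rewrite -EFinD; congr EFin; lra.
Qed.

(** Both sides compute the measure of the pairs (x, y) such that P x is in E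
    and y - P x is in F: integrating over y first gives the left-hand side;
    integrating over x first, after the translation of x by N y, gives the
    right-hand side. *)
Lemma lebesgue_linear_swap (P N : 'M[R]_n) E F :
  P *m N = 1%:M -> measurable E -> measurable F ->
  (la F * la [set x | E (P *m x)%R] = la E * la [set x | F (- (P *m x))%R])%E.
Proof.
move=> PN mE mF.
have mP := measurable_mulmx P.
(* The indicator of the pairs that both sides count. *)
pose h (z : 'cV[R]_n * 'cV[R]_n) : \bar R :=
  (\1_[set z | E (P *m z.1) /\ F (z.2 - P *m z.1)] z)%:E.
have mS : measurable [set z : 'cV[R]_n * 'cV[R]_n |
    E (P *m z.1) /\ F (z.2 - P *m z.1)].
  apply: measurableI.
    apply: measurable_setT_preimage mE.
    exact: (measurableT_comp mP measurable_fst).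
  apply: measurable_setT_preimage mF; apply: measurable_mxB.
    exact: measurable_snd.
  exact: (measurableT_comp mP measurable_fst).
have mh : measurable_fun setT h by apply/measurable_EFinP; exact: measurable_indic.
have h0 z : (0 <= h z)%E by rewrite lee_fin.
have L : (\int[la]_x \int[la]_y h (x, y) = la F * la [set x | E (P *m x)%R])%E.
  transitivity (\int[la]_x (la F * (\1_[set x | E (P *m x)%R] x)%:E))%E.
    apply: eq_integral => x _; rewrite /h.
    transitivity (\int[la]_y
        ((\1_[set y | E (P *m x)%R /\ F (y - P *m x)%R] y)%:E))%E.
      by apply: eq_integral => y _; rewrite !indicE.
    rewrite integral_indic ?setIT//; last first.
      have [e|e] := pselect (E (P *m x)%R).
        rewrite (_ : [set _ | _] = [set y | F (y - P *m x)%R]).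
          by apply: measurable_setT_preimage mF; exact: measurable_trans.
        by apply/seteqP; split=> y //= [].
      rewrite (_ : [set _ | _] = set0)//.
      by apply/seteqP; split=> y //= [].
    rewrite indicE; have [e|e] := pselect (E (P *m x)%R).
      rewrite mem_set// mule1 -(lebesgue_cV_translate (- (P *m x)) mF).
      by congr (la _); apply/seteqP; split=> y //= [].
    rewrite memNset// mule0 -[RHS](measure0 la).
    by congr (la _); apply/seteqP; split=> y //= [].
  rewrite ge0_integralZl//; last first.
    apply/measurable_EFinP; apply: measurable_indic.
    exact: measurable_setT_preimage.
  by rewrite integral_indic ?setIT//; exact: measurable_setT_preimage.
rewrite -L fubini_tonelli//.
pose h' (z : 'cV[R]_n * 'cV[R]_n) : \bar R :=
  (\1_[set z | E (P *m z.1 + z.2) /\ F (- (P *m z.1))] z)%:E.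
have mS' : measurable [set z : 'cV[R]_n * 'cV[R]_n |
    E (P *m z.1 + z.2) /\ F (- (P *m z.1))].
  apply: measurableI.
    apply: measurable_setT_preimage mE; apply: measurable_mxD.
      exact: (measurableT_comp mP measurable_fst).
    exact: measurable_snd.
  apply: measurable_setT_preimage mF; apply: measurable_mxN.
  exact: (measurableT_comp mP measurable_fst).
have mh' : measurable_fun setT h'.
  by apply/measurable_EFinP; exact: measurable_indic.
have h'0 z : (0 <= h' z)%E by rewrite lee_fin.
transitivity (\int[la]_y \int[la]_x h' (x, y))%E.
  apply: eq_integral => y _; rewrite /h /h'.
  transitivity (\int[la]_x
     (\1_[set x | E (P *m x)%R /\ F (y - P *m x)%R] x)%:E)%E.
    by apply: eq_integral => x _; rewrite !indicE.
  transitivity (\int[la]_x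
     (\1_[set x | E (P *m x + y)%R /\ F (- (P *m x))%R] x)%:E)%E; last first.
    by apply: eq_integral => x _; rewrite !indicE.
  have m1 : measurable [set x | E (P *m x)%R /\ F (y - P *m x)%R].
    apply: measurableI; first exact: measurable_setT_preimage.
    apply: measurable_setT_preimage mF; exact: measurable_mxB.
  rewrite !integral_indic ?{1}setIT ?setIT//; last first.
    apply: measurableI.
      by apply: measurable_setT_preimage mE; exact: measurable_mxD.
    by apply: measurable_setT_preimage mF; exact: measurable_mxN.
  apply: etrans (esym (lebesgue_cV_translate (N *m y) m1)) _.
  congr (la _); apply/seteqP; split=> x /=;
    by rewrite mulmxDr mulmxA PN mul1mx opprD (addrCA y) subrr addr0.
rewrite -(fubini_tonelli h')//.
transitivity (\int[la]_x (la E * (\1_[set x | F (- (P *m x))%R] x)%:E))%E.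
  apply: eq_integral => x _; rewrite /h'.
  transitivity (\int[la]_y
      ((\1_[set y | E (P *m x + y)%R /\ F (- (P *m x))%R] y)%:E))%E.
    by apply: eq_integral => y _; rewrite !indicE.
  rewrite integral_indic ?setIT//; last first.
    have [e|e] := pselect (F (- (P *m x))%R).
      rewrite (_ : [set _ | _] = [set y | E (P *m x + y)%R]).
        by apply: measurable_setT_preimage mE; exact: measurable_mxD.
      by apply/seteqP; split=> y //= [].
    rewrite (_ : [set _ | _] = set0)//.
    by apply/seteqP; split=> y //= [].
  rewrite indicE; have [e|e] := pselect (F (- (P *m x))%R).
    rewrite mem_set// mule1 -(lebesgue_cV_translate (P *m x) mE).
    by congr (la _); apply/seteqP; split=> y //=; rewrite addrC // => -[].
  rewrite memNset// mule0 -[RHS](measure0 la).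
  by congr (la _); apply/seteqP; split=> y //= [].
have mFP : measurable [set x | F (- (P *m x))%R].
  by apply: measurable_setT_preimage mF; exact: measurable_mxN.
rewrite ge0_integralZl//; last first.
  by apply/measurable_EFinP; exact: measurable_indic.
by rewrite integral_indic ?setIT.
Qed.

(** The absolute value of the determinant of P^-1, for invertible P. *)
Definition linear_scale (P : 'M[R]_n) := la [set x | half_open_cube (P *m x)].

(** [lebesgue_linear_swap] with F the unit cube shows that the left-hand side is
    proportional to the measure of E; taking E to be the cube identifies the
    factor. *)
Lemma lebesgue_linear (P N : 'M[R]_n) E : P *m N = 1%:M -> measurable E ->
  (la [set x | E (P *m x)%R] = linear_scale P * la E)%E.
Proof.
move=> PN mE; have mQ := @measurable_half_open_cube.
have /= := lebesgue_linear_swap PN mQ mQ.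
rewrite lebesgue_half_open_cube !mul1e => cE.
have := lebesgue_linear_swap PN mE mQ.
by rewrite lebesgue_half_open_cube mul1e -cE muleC.
Qed.

End scaling.

Section packing.
Context {R : realType} {n : nat}.
Notation la := (lebesgue_cV n).

(** If the translates U' + tau_i cover U while the translates U - tau_i are
    disjoint, then cutting U along the former and moving the pieces into U'
    embeds U into U'.  All comparisons between fundamental domains of lattices
    are instances of this lemma. *)
Lemma lebesgue_packing (I : countType) (tau : I -> 'cV[R]_n) (U U' : set 'cV[R]_n) :
  measurable U -> measurable U' ->
  (forall x, U x -> exists i, U' (x - tau i)) ->
  (forall i j x, U' x -> U (x + tau i) -> U (x + tau j) -> i = j) ->
  (la U <= la U')%E.
Proof.
move=> mU mU' cov disj.
pose A i := [set x | U x /\ U' (x - tau i)].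
pose A' i := [set x | U (x + tau i) /\ U' x].
have mA i : measurable (A i).
  apply: measurableI => //; apply: measurable_setT_preimage mU'.
  exact: measurable_trans.
have mA' i : measurable (A' i).
  apply: measurableI => //; apply: measurable_setT_preimage mU.
  exact: measurable_trans.
(* Sequences of sets: the empty set stands at the numbers that code no index. *)
pose An m := oapp A set0 (pickle_inv m); pose A'n m := oapp A' set0 (pickle_inv m).
have mAn m : measurable (An m) by rewrite /An; case: (pickle_inv _) => [i|] /=.
have mA'n m : measurable (A'n m) by rewrite /A'n; case: (pickle_inv _) => [i|] /=.
have AA' m : la (An m) = la (A'n m).
  rewrite /An /A'n; case: (pickle_inv m) => //= i.
  rewrite -(lebesgue_cV_translate (tau i) (mA i)); congr (la _).
  by apply/seteqP; split=> x; rewrite /A /A' /= addrK.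
apply: (@le_trans _ _ (\sum_(m <oo) la (An m))%E).
  apply: measure_sigma_subadditive => // x Ux.
  have [i U'x] := cov _ Ux; exists (pickle i) => //.
  by rewrite /An pickleK_inv.
rewrite (eq_eseriesr (fun m _ => AA' m)).
rewrite -measure_semi_bigcup//.
- apply: le_measure; rewrite ?inE//; first exact: bigcupT_measurable.
  by move=> x [m _]; rewrite /A'n; case: (pickle_inv m) => //= i [].
- apply/trivIsetP => p q _ _ pq; apply/seteqP; split=> x //= [].
  rewrite /A'n; have := @pickle_invK I p; have := @pickle_invK I q.
  case: (pickle_inv p) => [i|]//=; case: (pickle_inv q) => [j|]//= pj pi.
  case=> Ui U'x [Uj _]; have ij := disj _ _ _ U'x Ui Uj.
  by move/eqP: pq; apply; rewrite -pi -pj ij.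
- exact: bigcupT_measurable.
Qed.

End packing.

(** * Integer vectors, cubes and rounding *)
Section lattice.
Context {R : realType} {n : nat}.
Implicit Types (k l : 'cV[int]_n) (x y : 'cV[R]_n).

Local Notation ir := (int_mx R).

Lemma int_mxD k l : ir (k + l) = ir k + ir l.
Proof. exact: map_mxD. Qed.

Lemma int_mxB k l : ir (k - l) = ir k - ir l.
Proof. exact: map_mxB. Qed.

Lemma int_mx0 : ir (0 : 'cV[int]_n) = 0.
Proof. exact: map_mx0. Qed.

Lemma int_mxM (B : 'M[int]_n) k : ir (B *m k) = ir B *m ir k.
Proof. exact: map_mxM. Qed.

Definition round_cV x : 'cV[int]_n := \col_i Num.floor (x i ord0 + 1 / 2).

Lemma round_cVP x : half_open_cube (x - ir (round_cV x)).
Proof.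
move=> i; rewrite !mxE; set y := x i ord0.
have /andP[] := floor_itv (y + 1 / 2); rewrite rmorphD/= -?[1%:~R]/1.
by move=> h1 h2; apply/andP; split; lra.
Qed.

Lemma half_open_cube_int_inj x k l :
  half_open_cube (x - ir k) -> half_open_cube (x - ir l) -> k = l.
Proof.
move=> xk xl; apply/colP => i; have := xk i; have := xl i; rewrite !mxE.
set a := k i 0; set b := l i 0; move=> /andP[h1 h2] /andP[h3 h4].
have h5 : `|(a - b)%:~R : R| < 1.
  by rewrite rmorphB/= ltr_norml; apply/andP; split; lra.
move: h5; rewrite -intr_norm -[1]/(1%:~R) ltr_int.
rewrite ltz_nat ltnS leqn0 absz_eq0 subr_eq0 => /eqP//.
Qed.

Definition sup_ball (c : R) : set 'cV[R]_n := [set x | forall i, `|x i ord0| <= c].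

Lemma half_open_cube_sup_ball x : half_open_cube x -> sup_ball (1 / 2) x.
Proof. by move=> h i; rewrite ler_norml; have /andP[h1 h2] := h i; lra. Qed.

Lemma sup_ballD c d x y : sup_ball c x -> sup_ball d y -> sup_ball (c + d) (x + y).
Proof. by move=> h1 h2 i; rewrite mxE (le_trans (ler_normD _ _))// lerD. Qed.

Lemma sup_ballN c x : sup_ball c x -> sup_ball c (- x).
Proof. by move=> h i; rewrite mxE normrN. Qed.

Lemma sup_ballB c d x y : sup_ball c x -> sup_ball d y -> sup_ball (c + d) (x - y).
Proof. by move=> h1 /sup_ballN; exact: sup_ballD. Qed.

Lemma sup_ball_le c d x : c <= d -> sup_ball c x -> sup_ball d x.
Proof. by move=> cd h i; rewrite (le_trans (h i)). Qed.

Lemma measurable_sup_ball c : measurable (sup_ball c).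
Proof.
rewrite (_ : sup_ball c = \bigcap_(i in [set: 'I_n])
    ((fun v : 'cV[R]_n => v i ord0) @^-1` `[- c, c])).
  apply: fin_bigcap_measurable => [|i _]; first exact: finite_finset.
  by apply: measurable_setT_preimage => //; exact: measurable_mx_coord.
by apply/seteqP; split=> x h i => [_|]; have := h i;
  rewrite /= in_itv/= ler_norml //; exact.
Qed.

Lemma lebesgue_sup_ball_fin c : (lebesgue_cV n (sup_ball c) < +oo)%E.
Proof.
have -> : sup_ball c = [set v : 'cV[R]_n |
    forall i, `[- c, c]%classic (v i ord0)].
  by apply/seteqP; split=> x h i; have := h i; rewrite /= in_itv/= ler_norml.
rewrite (@lebesgue_cV_box R n (fun=> `[- c, c]%classic)) => [|i]; last first.
  exact: measurable_itv.
suff /andP[] : (0 <= \prod_(i < n) @lebesgue_measure R (`[(- c)%R, c]%classic : set R) < +oo)%E.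
  by [].
elim/big_ind: _ => [|x y /andP[x0 xoo] /andP[y0 yoo]|i _].
- by rewrite lee01 ltry.
- by rewrite mule_ge0// lte_mul_pinfty// ge0_fin_numE.
- rewrite measure_ge0 lebesgue_measure_itv/=; case: ifPn => // _.
  by rewrite -EFinD ltry.
Qed.

(** Enumerates the integer vectors whose entries lie between - c and c. *)
Definition int_box (c : nat) : seq 'cV[int]_n :=
  [seq \col_i ((f i : nat)%:Z - c%:Z) | f : {ffun 'I_n -> 'I_(2 * c).+1}].

Lemma mem_int_box c k : (forall i, `|k i ord0| <= c%:Z) -> k \in int_box c.
Proof.
move=> kc; apply/mapP.
have lt i : (absz (k i ord0 + c%:Z)%R < (2 * c).+1)%N.
  by have := kc i; lia.
exists [ffun i => Ordinal (lt i)]; first by rewrite mem_enum.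
apply/colP => i.
rewrite !mxE ffunE /= -[k i 0]/(k i ord0); have := kc i.
by move: (k i ord0) => z; lia.
Qed.

Lemma sup_ball_int_box (c : nat) k : sup_ball c%:R (ir k) -> k \in int_box c.
Proof.
move=> kc; apply: mem_int_box => i; have := kc i.
by rewrite mxE -intr_norm -[c%:R]/(c%:Z%:~R) ler_int.
Qed.

End lattice.

(** Plays the role of compactness: finitely many candidates, each surviving or
    eliminated for good, and at every stage at least one survivor. *)
Lemma decreasing_pigeonhole (T : eqType) (s : seq T) (P : nat -> T -> Prop) :
  (forall m t, P m.+1 t -> P m t) ->
  (forall m, exists2 t, t \in s & P m t) -> exists2 t, t \in s & forall m, P m t.
Proof.
move=> dec ex; apply: contrapT => H.
have {}H t : t \in s -> exists m, ~ P m t.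
  by move=> ts; apply/existsNP => h; apply: H; exists t.
have decm m p t : (m <= p)%N -> P p t -> P m t.
  by elim: p => [|p IH]; [rewrite leqn0 => /eqP->
    |rewrite leq_eqVlt => /orP[/eqP->//|/IH h /dec/h]].
suff [m Hm] : exists m, forall t, t \in s -> ~ P m t.
  by have [t ts Pt] := ex m; exact: Hm Pt.
elim: s H {ex} => [|a s IH] H; first by exists 0%N.
have [m Hm] := H a (mem_head _ _).
have [t ts|p Hp] := IH; first by apply: H; rewrite inE ts orbT.
exists (maxn m p) => t; rewrite inE => /orP[/eqP->|ts Pt].
  by move/(decm _ _ _ (leq_maxl m p)).
exact: Hp ts (decm _ _ _ (leq_maxr m p) Pt).
Qed.

(** * The self-affine tile *)

(** N is the inverse of B over the reals and contracts the sup norm.  Any factor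
    below 1/2 would do: it is compared with the half-width of the unit cube. *)
Record contracting_inverse (R : realType) n (B : 'M[int]_n) (N : 'M[R]_n) :
    Prop := ContractingInverse {
  contr_mulmxV : int_mx R B *m N = 1%:M;
  contr_mulVmx : N *m int_mx R B = 1%:M;
  contr_sup_ball : forall c x, sup_ball c x -> sup_ball (c / 4) (N *m x) }.

Section tile.
Context {R : realType} {n : nat} (B : 'M[int]_n) (N : 'M[R]_n).
Hypothesis BN : contracting_inverse B N.
Local Notation ir := (int_mx R).
Local Notation M := (int_mx R B).
Local Notation Q := half_open_cube.

Lemma contrK (x : 'cV[R]_n) : N *m (M *m x) = x.
Proof. by rewrite mulmxA (contr_mulVmx BN) mul1mx. Qed.

Lemma contrVK (x : 'cV[R]_n) : M *m (N *m x) = x.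
Proof. by rewrite mulmxA (contr_mulmxV BN) mul1mx. Qed.

(** The integer vectors of the image BQ of the half-open unit cube; the entries of
    such a vector are bounded by half the sum of the absolute values of the
    entries of B. *)
Definition digits : seq 'cV[int]_n :=
  undup [seq d <- int_box (\sum_i \sum_j absz (B i j))%N | `[< Q (N *m ir d) >]].

Lemma mem_digits d : d \in digits <-> Q (N *m ir d).
Proof.
rewrite mem_undup mem_filter; split => [/andP[/asboolP]//|Qd].
apply/andP; split; first exact/asboolP.
apply: (@sup_ball_int_box R) => i; rewrite -[ir d]contrVK mxE.
apply: le_trans (ler_norm_sum _ _ _) _.
apply: (@le_trans _ _ (\sum_j absz (B i j))%N%:R); last first.
  by rewrite [in leRHS](bigD1 i)//= natrD lerDl.
rewrite natr_sum; apply: ler_sum => j _; rewrite normrM !mxE.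
rewrite -intr_norm -[leRHS]mulr1 ler_pM//; last first.
  by have := half_open_cube_sup_ball Qd j; rewrite mxE => h; apply: le_trans h _; lra.
Qed.

Lemma digit0 : 0 \in digits.
Proof. by apply/mem_digits => i; rewrite int_mx0 mulmx0 mxE; lra. Qed.

Lemma digit_sup_ball d : d \in digits -> sup_ball (1 / 2) (N *m ir d).
Proof. by move/mem_digits/half_open_cube_sup_ball. Qed.

(** Division with remainder by B: the quotient is N l rounded. *)
Lemma digit_decomposition l : exists2 d, d \in digits & exists z, l = d + B *m z.
Proof.
pose z := round_cV (N *m ir l); exists (l - B *m z); last by exists z; rewrite subrK.
apply/mem_digits; rewrite int_mxB int_mxM mulmxBr contrK; exact: round_cVP.
Qed.

(** N d lies in the cube Q, so the quotient of d + B z by B is the only integer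
    vector that differs from N (d + B z) by an element of Q. *)
Lemma digit_decomposition_inj d d' z z' : d \in digits -> d' \in digits ->
  d + B *m z = d' + B *m z' -> d = d' /\ z = z'.
Proof.
move=> /mem_digits dD /mem_digits d'D e.
suff zz' : z = z' by split=> //; move: e; rewrite zz' => /addIr.
have E k : N *m ir k = N *m ir (k + B *m z) - ir z.
  by rewrite int_mxD int_mxM mulmxDr contrK addrK.
have E' k : N *m ir k = N *m ir (k + B *m z') - ir z'.
  by rewrite int_mxD int_mxM mulmxDr contrK addrK.
apply: (@half_open_cube_int_inj R _ (N *m ir (d + B *m z))).
  by rewrite -E.
by rewrite e -E'.
Qed.

(** The tile is the set of the series of terms N^j d_j over j >= 1, with digits
    d_j; [tile_approx] fixes the first m digits and leaves the tail free in the
    cube of radius 1.  In this form the tile is a decreasing intersection of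
    Borel sets, and each of its properties passes to the limit by pigeonhole. *)
Fixpoint tile_approx m : set 'cV[R]_n := if m is m'.+1 then
  [set x | exists2 d, d \in digits & tile_approx m' (M *m x - ir d)]
  else sup_ball 1.

Definition tile : set 'cV[R]_n := \bigcap_m tile_approx m.

(** The cube of radius 1 is stable under x -> N (x + d), because
    1/4 + 1/2 <= 1. *)
Lemma tile_approx_decr m : tile_approx m.+1 `<=` tile_approx m.
Proof.
elim: m => [|m IH] x [d dD]; last by move/IH => h; exists d.
move/(contr_sup_ball BN); rewrite mulmxBr contrK => h.
have := sup_ballD h (digit_sup_ball dD); rewrite subrK.
by apply: sup_ball_le; lra.
Qed.

Lemma tile_sup_ball : tile `<=` sup_ball 1.
Proof. by move=> x /(_ 0%N I). Qed.

(** The self-affinity BT = T + digits. *)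
Lemma tile_refine x : tile x <-> exists2 d, d \in digits & tile (M *m x - ir d).
Proof.
split=> [Tx|[d dD Td]].
  have [] := @decreasing_pigeonhole _ digits
      (fun m d => tile_approx m (M *m x - ir d)).
  - by move=> m d; exact: tile_approx_decr.
  - by move=> m; exact: Tx m.+1 I.
  - by move=> d dD h; exists d => // m _.
case=> [_|m _]; last by exists d => //; exact: Td.
by apply: tile_approx_decr; exists d => //; exact: Td.
Qed.

(** Every approximation covers the space with its integer translates, since the
    digits represent all classes modulo B; only finitely many translates are
    near a given point, so one of them contains it at every stage. *)
Lemma tile_cover x : exists k, tile (x - ir k).
Proof.
have cov m : exists k, tile_approx m (x - ir k).
  elim: m x => [|m IH] x.
    exists (round_cV x); apply: sup_ball_le (half_open_cube_sup_ball (round_cVP x)).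
    lra.
  have [l Tl] := IH (M *m x); have [d dD [z lE]] := digit_decomposition l.
  exists z, d => //; rewrite mulmxBr -addrA -opprD -int_mxM -int_mxD.
  by rewrite [B *m z + d]addrC -lE.
(* Bounds the entries of the integer vectors at distance at most 1 from x. *)
pose c := (\sum_i absz (Num.ceil `|x i ord0|)).+1.
have [] := @decreasing_pigeonhole _ (int_box c)
      (fun m k => tile_approx m (x - ir k)).
- by move=> m k; exact: tile_approx_decr.
- move=> m; have [k Tk] := cov m; exists k => //.
  apply: (@sup_ball_int_box R) => i.
  have : sup_ball 1 (x - ir k).
    by elim: m Tk => // m IH /tile_approx_decr/IH.
  move=> /(_ i) /[!mxE]; set a := x i ord0; set b := _%:~R => h.
  have ac : `|a| + 1 <= c%:R.
    rewrite /c -[leRHS]natr1 lerD2r; apply: le_trans (ceil_ge _) _.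
    apply: (@le_trans _ _ (absz (Num.ceil `|a|))%:R); last first.
      by rewrite (bigD1 i)//= natrD lerDl.
    by rewrite -[leRHS]/((absz _)%:Z%:~R) ler_int abszE ler_norm.
  apply: le_trans ac; rewrite -[b](subrKC a); apply: le_trans (ler_normD _ _) _.
  by rewrite lerD2l distrC.
- by move=> k _ Tk; exists k => m _.
Qed.

Lemma measurable_tile : measurable tile.
Proof.
apply: bigcapT_measurable; elim=> [|m IH] /=; first exact: measurable_sup_ball.
rewrite (_ : [set x | _] = \bigcup_(d in [set` digits])
   [set x | tile_approx m (M *m x - ir d)]); last first.
  by apply/seteqP; split=> x [d dD Td]; exists d.
apply: fin_bigcup_measurable => [|d _]; first exact: finite_seq.
apply: measurable_setT_preimage IH; exact: measurable_affine.
Qed.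

(** The integer vectors d_0 + B d_1 + ... + B^(m-1) d_(m-1). *)
Fixpoint digit_expansions m : seq 'cV[int]_n := if m is m'.+1 then
  [seq d + B *m e | d <- digits, e <- digit_expansions m'] else [:: 0].

Lemma size_digit_expansions m : size (digit_expansions m) = (size digits ^ m)%N.
Proof. by elim: m => //= m IH; rewrite size_allpairs IH expnS. Qed.

Lemma digit_expansions0 m : 0 \in digit_expansions m.
Proof.
elim: m => [|m IH]; first by rewrite inE.
by apply/allpairsP; exists (0, 0); rewrite digit0 IH mulmx0 addr0.
Qed.

(** Division by B sends a vector of sup norm at most c + 1 to one of sup norm at
    most (c + 1) / 4 + 1 / 2 < c + 1, so the successive quotients reach 0. *)
Lemma digit_expansions_exhaust z : exists m, z \in digit_expansions m.
Proof.
have [c zc] : exists c : nat, forall i, `|z i ord0| <= c%:Z.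
  exists (\sum_i absz (z i ord0))%N => i.
  by rewrite (bigD1 i)//= PoszD -abszE lerDl.
elim: c z zc => [|c IH] z zc.
  exists 0%N; rewrite inE; apply/eqP/colP => i; rewrite mxE.
  by have := zc i; rewrite normr_le0 => /eqP.
have [d dD [z' zE]] := digit_decomposition z.
have zb : sup_ball c.+1%:R (ir z).
  by move=> i; rewrite mxE -intr_norm -[c.+1%:R]/(c.+1%:Z%:~R) ler_int.
have : ir z' = N *m ir z - N *m ir d.
  by rewrite zE int_mxD int_mxM mulmxDr contrK addrC addKr.
move=> z'E; have := sup_ballB (contr_sup_ball BN zb) (digit_sup_ball dD).
rewrite -z'E => z'b.
have [m mz'] : exists m, z' \in digit_expansions m.
  apply: IH => i; have := z'b i; rewrite mxE -intr_norm => h.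
  rewrite -ltzD1 -PoszD addn1 -(ltr_int R) (le_lt_trans h)//.
  rewrite -[c.+1%:Z%:~R]/(c.+1%:R) -natr1; have : 0 <= c%:R :> R by [].
  lra.
by exists m.+1; apply/allpairsP; exists (d, z').
Qed.

End tile.

(** * The tile is a fundamental domain of Z^n *)
Section tile_measure.
Context {R : realType} {n : nat} (B : 'M[int]_n) (N : 'M[R]_n).
Hypothesis BN : contracting_inverse B N.
Local Notation ir := (int_mx R).
Local Notation M := (int_mx R B).
Local Notation la := (lebesgue_cV n).
Local Notation T := (tile B N).
Local Notation D := (digits B N).

Definition translates (E : set 'cV[R]_n) (s : seq 'cV[int]_n) : set 'cV[R]_n :=
  [set x | exists2 d, d \in s & E (x - ir d)].

(* Instances of the general facts on measures in which the measure is spelled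
   [lebesgue_cV n], so that the lemmas on that measure rewrite in the result. *)
Let lebesgueU2 (E F : set 'cV[R]_n) : measurable E -> measurable F ->
  (la (E `|` F) <= la E + la F)%E.
Proof. exact: measureU2. Qed.

Let lebesgueU (E F : set 'cV[R]_n) : measurable E -> measurable F ->
  E `&` F = set0 -> la (E `|` F) = (la E + la F)%E.
Proof. exact: measureU. Qed.

Let lebesgueD (E F : set 'cV[R]_n) : measurable E -> measurable F ->
  (la E < +oo)%E -> la (E `\` F) = (la E - la (E `&` F))%E.
Proof. exact: measureD. Qed.

Definition shift_set (E : set 'cV[R]_n) (k : 'cV[int]_n) : set 'cV[R]_n :=
  [set x | E (x - ir k)].

Lemma translates_cons E k s :
  translates E (k :: s) = shift_set E k `|` translates E s.
Proof.
apply/seteqP; split=> x [].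
- move=> d; rewrite inE => /orP[/eqP-> Ex|ds Ex]; first by left.
  by right; exists d.
- by move=> Ex; exists k; rewrite ?mem_head.
- by case=> d ds Ex; exists d; rewrite // inE ds orbT.
Qed.

Lemma measurable_shift_set E k : measurable E -> measurable (shift_set E k).
Proof. by move=> mE; apply: measurable_setT_preimage mE; exact: measurable_trans. Qed.

Lemma lebesgue_shift_set E k : measurable E -> la (shift_set E k) = la E.
Proof. exact: lebesgue_cV_translate. Qed.

Lemma measurable_translates E s : measurable E -> measurable (translates E s).
Proof.
move=> mE; elim: s => [|k s IH]; last first.
  by rewrite translates_cons; apply: measurableU => //; exact: measurable_shift_set.
by rewrite (_ : translates E [::] = set0)//; apply/seteqP; split=> x // [].
Qed.

Lemma lebesgue_translates_le E s : measurable E ->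
  (la (translates E s) <= (size s)%:R%:E * la E)%E.
Proof.
move=> mE; elim: s => [|k s IH].
  by rewrite (_ : translates E [::] = set0) ?measure0 ?mul0e//; apply/seteqP; split=> x // [].
rewrite translates_cons; apply: le_trans (lebesgueU2 _ _) _ => //.
- exact: measurable_shift_set.
- exact: measurable_translates.
rewrite lebesgue_shift_set// /= -(add1n (size s)) natrD EFinD ge0_muleDl// ?mul1e ?lee_fin//.
exact: leeD2l.
Qed.

Lemma lebesgue_translates E s : measurable E -> uniq s ->
  (forall k l x, E (x - ir k) -> E (x - ir l) -> k = l) ->
  la (translates E s) = ((size s)%:R%:E * la E)%E.
Proof.
move=> mE + dis; elim: s => [_|k s IH /= /andP[ks us]].
  by rewrite (_ : translates E [::] = set0) ?measure0 ?mul0e//; apply/seteqP; split=> x // [].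
rewrite translates_cons lebesgueU//.
- rewrite lebesgue_shift_set// IH// -(add1n (size s)) natrD EFinD.
  by rewrite ge0_muleDl// ?mul1e ?lee_fin.
- exact: measurable_shift_set.
- exact: measurable_translates.
- apply/seteqP; split=> x //= [Ek [l ls El]].
  by move: ks; rewrite (dis _ _ _ Ek El) ls.
Qed.

(** Both Q + digits and BQ are fundamental domains of the lattice B Z^n; the first
    has the number of digits as its measure. *)
Lemma size_digits_le : ((size D)%:R%:E <= linear_scale N)%E.
Proof.
have mQ := @measurable_half_open_cube R n.
rewrite -[leLHS]mule1 -(@lebesgue_half_open_cube R n) -lebesgue_translates//; last 2 first.
- exact: undup_uniq.
- by move=> k l x; exact: half_open_cube_int_inj.
apply: (lebesgue_packing (tau := fun z => ir (B *m z))) => //.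
- exact: measurable_translates.
- by apply: measurable_setT_preimage mQ; exact: measurable_mulmx.
- move=> x _; exists (round_cV (N *m x)) => /=.
  by rewrite mulmxBr int_mxM contrK//; exact: round_cVP.
- move=> i j x _ [d dD Qd] [e eD Qe].
  have de : d + B *m (- i) = e + B *m (- j).
    rewrite !mulmxN; apply: (@half_open_cube_int_inj R _ x).
      by rewrite int_mxB opprB addrCA addrA [_ + x]addrC.
    by rewrite int_mxB opprB addrCA addrA [_ + x]addrC.
  by have [_ /oppr_inj] := digit_decomposition_inj BN dD eD de.
Qed.

Lemma size_digits_expn_le m : ((size D ^ m)%N%:R%:E <= linear_scale N ^+ m)%E.
Proof.
elim: m => [|m IH]; first by rewrite expn0 expe0.
by rewrite expnS natrM EFinM expeS lee_pmul ?lee_fin// size_digits_le.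
Qed.

(** 0 and the first basis vector are digits. *)
Lemma size_digits_ge2 : (0 < n)%N -> (2 <= size D)%N.
Proof.
move=> n0; pose e : 'cV[int]_n := \col_i ((i : nat) == 0%N)%:R.
have eD : e \in D.
  apply/(mem_digits BN) => i.
  have : sup_ball 1 (ir e).
    by move=> j; rewrite !mxE; case: (_ == _); rewrite ?normr1 ?normr0.
  by move/(contr_sup_ball BN)/(_ i); rewrite ler_norml => /andP[]; lra.
have e0 : e != 0.
  by apply/eqP => /colP/(_ (Ordinal n0)); rewrite !mxE.
rewrite -[2%N]/(size [:: 0; e]); apply: uniq_leq_size.
  by rewrite /= inE eq_sym e0.
by move=> x; rewrite !inE => /orP[|] /eqP->//; exact: digit0.
Qed.

Lemma lebesgue_tile_fin : la T \is a fin_num.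
Proof.
rewrite ge0_fin_numE//; apply: le_lt_trans (lebesgue_sup_ball_fin 1).
apply: le_measure; rewrite ?inE; [exact: measurable_tile|exact: measurable_sup_ball|].
exact: tile_sup_ball.
Qed.

Lemma lebesgue_linear_iter m E : measurable E ->
  measurable [set x : 'cV[R]_n | E (iter m (mulmx N) x)] /\
  la [set x | E (iter m (mulmx N) x)] = (linear_scale N ^+ m * la E)%E.
Proof.
elim: m E => [|m IH] E mE; first by rewrite expe0 mul1e.
have mNE : measurable [set x | E (N *m x)].
  by apply: measurable_setT_preimage mE; exact: measurable_mulmx.
have [mm lm] := IH _ mNE; split=> //.
by rewrite lm (lebesgue_linear (contr_mulVmx BN))// muleA (muleC (_ ^+ m)%E) -expeS.
Qed.

Lemma tile_expansion m x : T (iter m (mulmx N) x) ->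
  translates T (digit_expansions B N m) x.
Proof.
elim: m x => [|m IH] x; first by exists 0; rewrite ?inE// int_mx0 subr0.
rewrite iterSr => /IH[e em /(tile_refine BN)[d dD]].
rewrite mulmxBr contrVK// -addrA -opprD -int_mxM -int_mxD => Te.
exists (d + B *m e); first by apply/allpairsP; exists (d, e).
by rewrite [d + _]addrC.
Qed.

(** Choose m such that 0 and k are both expansions of length m.  Then B^m T is
    covered by (size digits)^m translates of T, among which T and T + k; its
    measure is at least (size digits)^m times that of T, so the overlap of T
    and T + k cannot have positive measure. *)
Lemma tile_overlap0 k : k != 0 -> la (T `&` shift_set T k) = 0%E.
Proof.
move=> k0; have mT := measurable_tile B N.
have mTk := measurable_shift_set k mT.
have [m km] := digit_expansions_exhaust BN k.
have s0 := digit_expansions0 BN m.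
(* The remaining translates only enter through their number. *)
have [s' sE] : exists s', perm_eq (digit_expansions B N m) (0 :: k :: s').
  exists (rem k (rem 0 (digit_expansions B N m))).
  rewrite (permPl (perm_to_rem s0)) perm_cons; apply: perm_to_rem.
  by have := perm_mem (perm_to_rem s0) k;
    rewrite km inE (negbTE k0) /= => <-.
have sz : (size D ^ m = (size s').+2)%N.
  by rewrite -(size_digit_expansions B N) (perm_size sE).
have tE : translates T (digit_expansions B N m) =
    T `|` (shift_set T k `|` translates T s').
  rewrite (_ : translates T _ = translates T (0 :: k :: s')).
    by rewrite !translates_cons; congr (_ `|` _); apply/seteqP; split=> x;
      rewrite /shift_set /= int_mx0 subr0.
  by apply/seteqP; split=> x [d ds Td]; exists d; rewrite // ?(perm_mem sE) // -(perm_mem sE).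
have [mTm lTm] := lebesgue_linear_iter m mT.
have aE := lebesgue_tile_fin.
set I := T `&` _.
have mI : measurable I by exact: measurableI.
have IT : (la I <= la T)%E by apply: le_measure; rewrite ?inE// => x [].
have Ifin : la I \is a fin_num.
  rewrite ge0_fin_numE//; apply: le_lt_trans IT _; rewrite -ge0_fin_numE//.
have : (linear_scale N ^+ m * la T <= la T + ((la T - la I) + (size s')%:R%:E * la T))%E.
  rewrite -lTm; apply: (@le_trans _ _ (la (T `|` ((shift_set T k `\` T) `|` translates T s')))).
    apply: le_measure; rewrite ?inE//.
      by do 2?apply: measurableU => //; [exact: measurableD|exact: measurable_translates].
    move=> x /= /tile_expansion; rewrite tE => -[|[|]]; [by left| |by right; right].
    by move=> Tx; have [|] := pselect (T x); [left|right; left].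
  apply: le_trans (lebesgueU2 _ _) _ => //.
    by apply: measurableU => //; [exact: measurableD|exact: measurable_translates].
  apply: leeD2l; apply: le_trans (lebesgueU2 _ _) _ => //.
  - exact: measurableD.
  - exact: measurable_translates.
  apply: leeD; last exact: lebesgue_translates_le.
  rewrite lebesgueD//; last by rewrite lebesgue_shift_set// -ge0_fin_numE.
  by rewrite lebesgue_shift_set// setIC.
have Dm : ((size s').+2%:R%:E <= linear_scale N ^+ m)%E.
  by rewrite -sz size_digits_expn_le.
have DmT : ((size s').+2%:R%:E * la T <= linear_scale N ^+ m * la T)%E.
  exact: lee_wpmul2r.
move=> /(le_trans DmT).
rewrite -(fineK aE) -(fineK Ifin) -EFinB -!EFinM -!EFinD lee_fin => H.
have b0 : 0 <= fine (la I) by rewrite fine_ge0.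
congr EFin; apply/eqP; rewrite eq_le b0 andbT.
move: H; rewrite -(addn2 (size s')) natrD mulrDl; lra.
Qed.

Definition tile_overlap : set 'cV[R]_n :=
  [set x | exists k l, [/\ k != l, T (x - ir k) & T (x - ir l)]].

Lemma negligible_tile_overlap : la.-negligible tile_overlap.
Proof.
have mT := measurable_tile B N.
pose O (kl : 'cV[int]_n * 'cV[int]_n) : set 'cV[R]_n :=
  if kl.1 != kl.2 then shift_set T kl.1 `&` shift_set T kl.2 else set0.
have O0 kl : la.-negligible (O kl).
  rewrite /O; case: ifPn => [kl0|_]; last exact: negligible_set0.
  apply/negligibleP.
    by apply: measurableI => //; exact: measurable_shift_set.
  rewrite (_ : _ `&` _ = shift_set (T `&` shift_set T (kl.2 - kl.1)) kl.1).
    apply: etrans (lebesgue_shift_set _ _) _.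
      by apply: measurableI => //; exact: measurable_shift_set.
    by apply: tile_overlap0; rewrite subr_eq0 eq_sym.
  by apply/seteqP; split=> x; rewrite /shift_set /= int_mxB opprB addrA subrK.
apply: (negligibleS (A := \bigcup_m oapp O set0 (pickle_inv m))).
  move=> x [k [l [kl Tk Tl]]]; exists (pickle (k, l)) => //.
  by rewrite pickleK_inv /= /O /= kl.
apply: negligible_bigcup => m; case: (pickle_inv m) => [kl|] /=; first exact: O0.
exact: negligible_set0.
Qed.

(** Compare T with the unit cube by [lebesgue_packing] in both directions; for
    the upper bound the null set of overlaps is first removed from T, which
    makes its translates disjoint. *)
Lemma lebesgue_tile : la T = 1%E.
Proof.
have mT := measurable_tile B N; have mQ := @measurable_half_open_cube R n.
apply/eqP; rewrite eq_le -(@lebesgue_half_open_cube R n); apply/andP; split; last first.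
  apply: (lebesgue_packing (tau := fun k => ir k)) => //.
    by move=> x _; exact: (tile_cover BN).
  move=> i j x _ Qi Qj; apply/oppr_inj; apply: (@half_open_cube_int_inj R _ x).
    by rewrite -[- i]add0r int_mxB int_mx0 add0r opprK.
  by rewrite -[- j]add0r int_mxB int_mx0 add0r opprK.
have [Z [mZ Z0 oZ]] := negligible_tile_overlap.
apply: (@le_trans _ _ (la (T `\` Z))).
  apply: (@le_trans _ _ (la ((T `\` Z) `|` Z))).
    apply: le_measure; rewrite ?inE//; first by apply: measurableU => //; exact: measurableD.
    by move=> x Tx; have [|] := pselect (Z x); [right|left].
  apply: le_trans (lebesgueU2 _ _) _ => //; first exact: measurableD.
  by rewrite [X in (_ + X)%E](_ : _ = 0%E)// adde0.
apply: (lebesgue_packing (tau := fun k => ir k)) => //.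
- exact: measurableD.
- by move=> x _; exists (round_cV x); exact: round_cVP.
- move=> i j x _ [Ti nZ] [Tj _]; apply: contrapT => /eqP ij; apply: nZ; apply: oZ.
  exists 0, (i - j); rewrite eq_sym subr_eq0; split=> //.
    by rewrite int_mx0 subr0.
  by rewrite int_mxB opprB -addrA subrKC.
Qed.

End tile_measure.

(** * Powers of a dilation matrix have contracting inverses *)
Section modulus.
Context {R : realType}.
Implicit Types z w : R[i].

Definition modulus z : R := complex.Re `|z|.

Lemma modulusE z : ((modulus z)%:C)%C = `|z|.
Proof. exact: RRe_real (normr_real z). Qed.

Lemma modulus_ge0 z : 0 <= modulus z.
Proof. by rewrite -ler0c modulusE. Qed.

Lemma modulus0 : modulus 0 = 0.
Proof. by apply/complexI; rewrite modulusE normr0. Qed.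

Lemma modulusD z w : modulus (z + w) <= modulus z + modulus w.
Proof. by rewrite -lecR rmorphD/= !modulusE ler_normD. Qed.

Lemma modulusM z w : modulus (z * w) = modulus z * modulus w.
Proof. by apply/complexI; rewrite rmorphM/= !modulusE normrM. Qed.

Lemma modulus_real (x : R) : modulus (x%:C)%C = `|x|.
Proof. by rewrite /modulus normc_def /= expr0n/= addr0 sqrtr_sqr. Qed.

Lemma modulus_gt1 z : (1 < modulus z) = (1 < `|z|).
Proof. by rewrite -modulusE -[1 in RHS]/((1 : R)%:C)%C ltcR. Qed.

End modulus.

Section spectral.
Context {R : realType}.

(** From the moment when e is small, a contracts by the factor r up to an error
    that sums to a small geometric series. *)
Lemma cvg_linear_recurrence (r : R) (a e : R^nat) : 0 <= r < 1 ->
  (forall k, 0 <= a k) -> (forall k, a k.+1 <= r * a k + e k) ->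
  e @ \oo --> 0 -> a @ \oo --> 0.
Proof.
move=> /andP[r0 r1] a0 aS /cvgrPdist_le e0; apply/cvgrPdist_le => /= eps eps0.
have r1' : 0 < 1 - r by rewrite subr_gt0.
have [/= N _ HN] := e0 (eps / 2 * (1 - r)) (mulr_gt0 (divr_gt0 eps0 (ltr0Sn _ 1)) r1').
have aN j : a (N + j)%N <= r ^+ j * a N + eps / 2.
  elim: j => [|j IH]; first by rewrite addn0 expr0 mul1r lerDl divr_ge0 ?ltW.
  rewrite addnS; apply: le_trans (aS _) _.
  have := HN (N + j)%N (leq_addr _ _); rewrite /= sub0r normrN => /(le_trans (ler_norm _)) h.
  have := ler_wpM2l r0 IH; rewrite exprS mulrDr mulrA; lra.
have : (fun j => r ^+ j * a N) @ \oo --> 0 * a N.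
  by apply: cvgMl; apply: cvg_expr; rewrite ger0_norm.
rewrite mul0r => /cvgrPdist_le/(_ (eps / 2))[|/= J _ HJ]; first by rewrite divr_gt0.
exists (N + J)%N => //= k kNJ; rewrite sub0r normrN ger0_norm//.
have Nk : (N <= k)%N by apply: leq_trans kNJ; exact: leq_addr.
rewrite -(subnKC Nk); apply: le_trans (aN _) _.
have := HJ (k - N)%N; rewrite /= leq_subRL// => /(_ kNJ).
by rewrite sub0r normrN => /(le_trans (ler_norm _)); lra.
Qed.

(** By induction on the factors: U = (W - z) V is annihilated by one factor less,
    so W^k U tends to 0, and W^(k+1) V = z W^k V + W^k U is a linear recurrence
    with ratio z. *)
Lemma cvg_annihilated_power n (W : 'M[R[i]]_n.+1) (s : seq R[i]) (V : 'M[R[i]]_n.+1) :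
  (forall z, z \in s -> modulus z < 1) ->
  (\prod_(z <- s) (W - z%:M)) * V = 0 ->
  forall i j, (fun k => modulus ((W ^+ k * V) i j)) @ \oo --> (0 : R).
Proof.
elim/last_ind: s V => [|s z IH] V s1 H i j.
  rewrite (_ : (fun k => _) = cst 0); first exact: cvg_cst.
  apply/funext => k; move: H; rewrite big_nil mul1r => ->.
  by rewrite mulr0 mxE modulus0.
pose U := (W - z%:M) * V.
have HU : forall i j, (fun k => modulus ((W ^+ k * U) i j)) @ \oo --> (0 : R).
  apply: IH => [w ws|]; first by apply: s1; rewrite mem_rcons inE ws orbT.
  by rewrite mulrA -[RHS]H -cats1 big_cat big_seq1.
apply: (cvg_linear_recurrence (r := modulus z)
   (e := fun k => modulus ((W ^+ k * U) i j))) => //.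
- by rewrite modulus_ge0 s1// mem_rcons mem_head.
- by move=> k; exact: modulus_ge0.
- move=> k; have -> : W ^+ k.+1 * V = z *: (W ^+ k * V) + W ^+ k * U.
    rewrite /U mulrBl mulrBr exprSr mulrA.
    have -> : z%:M * V = z *: V by rewrite -mulmxE mul_scalar_mx.
    by rewrite -scalerAr addrC subrK.
  by rewrite mxE [X in X + _]mxE -modulusM modulusD.
Qed.

Lemma cvg_contracting_power n (W : 'M[R[i]]_n.+1) :
  (forall z, eigenvalue W z -> modulus z < 1) ->
  forall i j, (fun k => modulus ((W ^+ k) i j)) @ \oo --> (0 : R).
Proof.
move=> ev i j; have [s ps] := closed_field_poly_normal (char_poly W).
move: ps; rewrite (monicP (char_poly_monic W)) scale1r => ps.
have := Cayley_Hamilton W; rewrite ps rmorph_prod/= => CH.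
have := @cvg_annihilated_power n W s 1 _ _ i j.
rewrite (_ : (fun k => modulus ((W ^+ k * 1) i j)) = (fun k => modulus ((W ^+ k) i j))).
  apply => [z zs|].
    by apply: ev; rewrite eigenvalue_root_char ps root_prod_XsubC.
  rewrite mulr1 -[RHS]CH; apply: eq_bigr => z _.
  by rewrite rmorphB/= horner_mx_X horner_mx_C.
by apply/funext => k; rewrite mulr1.
Qed.

Lemma dilation_unit n (A : 'M[int]_n.+1) :
  dilation_matrix R A -> int_mx R A \is a GRing.unit.
Proof.
move=> dA; rewrite -[_ \is a _]/(_ \in unitmx) unitmxE unitfE; apply/negP => /det0P[v v0 vA].
have /dA : eigenvalue (int_mx R[i] A) 0.
  apply/eigenvalueP; exists (map_mx (real_complex R) v).
    rewrite scale0r; have -> : int_mx R[i] A = map_mx (real_complex R) (int_mx R A).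
      by apply/matrixP => i j; rewrite !mxE rmorph_int.
    by rewrite -map_mxM vA map_mx0.
  by rewrite map_mx_eq0.
by rewrite normr0 ltr10.
Qed.

Lemma dilation_inverse_cvg n (A : 'M[int]_n.+1) : dilation_matrix R A ->
  forall i j, (fun k => ((int_mx R A)^-1 ^+ k) i j) @ \oo --> (0 : R).
Proof.
move=> dA i j; have uA := dilation_unit dA.
pose W := map_mx (real_complex R) (int_mx R A)^-1.
have WA : W * int_mx R[i] A = 1.
  have -> : int_mx R[i] A = map_mx (real_complex R) (int_mx R A).
    by apply/matrixP => p q; rewrite !mxE rmorph_int.
  by rewrite -mulmxE -map_mxM mulmxE mulVr// map_mx1.
apply/norm_cvg0P; have := @cvg_contracting_power n W _ i j.
rewrite (_ : (fun k => modulus ((W ^+ k) i j)) =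
  (fun k => `|((int_mx R A)^-1 ^+ k) i j|)).
  apply=> z /eigenvalueP[v vW v0].
  have vE : v = z *: (v *m int_mx R[i] A).
    by rewrite scalemxAl -vW -mulmxA [W *m _]WA mulmx1.
  have z0 : z != 0 by apply: contraNneq v0 => z0; rewrite vE z0 scale0r.
  have /dA : eigenvalue (int_mx R[i] A) z^-1.
    apply/eigenvalueP; exists v => //.
    by rewrite [in RHS]vE scalerA mulVf// scale1r.
  rewrite -modulus_gt1 => zi; have zz : modulus z * modulus z^-1 = 1.
    by rewrite -modulusM divff// /modulus normr1.
  have zp : 0 < modulus z.
    by rewrite lt_def modulus_ge0 andbT; apply/eqP => h; move: zz; rewrite h mul0r; lra.
  by rewrite -zz -[ltLHS]mulr1 ltr_pM2l.
apply/funext => k; rewrite -modulus_real; congr modulus.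
by rewrite /W -rmorphXn /= mxE.
Qed.

Lemma contracting_inverse_small n (B : 'M[int]_n) (N : 'M[R]_n) :
  (0 < n)%N -> int_mx R B *m N = 1%:M ->
  (forall i j, `|N i j| <= (4 * n%:R)^-1) -> contracting_inverse B N.
Proof.
move=> n0 BN Ns; have nR : 0 < n%:R :> R by rewrite ltr0n.
split=> //; first exact: mulmx1C.
move=> c x xc i; rewrite mxE; apply: le_trans (ler_norm_sum _ _ _) _.
apply: (@le_trans _ _ (\sum_(j < n) (4 * n%:R)^-1 * c)).
  by apply: ler_sum => j _; rewrite normrM ler_pM.
rewrite sumr_const card_ord.
suff -> : ((4 * n%:R)^-1 * c) *+ n = c / 4 by [].
rewrite -mulr_natl; move: (n%:R : R) nR => m m0.
by field; rewrite gt_eqF.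
Qed.

(** An eigenvector v for z satisfies v = z v N; comparing sums of moduli gives
    |z| >= 4. *)
Lemma contracting_inverse_dilation n (B : 'M[int]_n) (N : 'M[R]_n) :
  int_mx R B *m N = 1%:M ->
  (forall i j, `|N i j| <= (4 * n%:R)^-1) -> dilation_matrix R B.
Proof.
move=> BN Ns z /eigenvalueP[v vB v0].
have n0 : (0 < n)%N.
  by case: n B N BN Ns v vB v0 => // B N _ _ v _; rewrite (thinmx0 v) eqxx.
have nR : 0 < n%:R :> R by rewrite ltr0n.
pose NC := map_mx (real_complex R) N.
have BNC : int_mx R[i] B *m NC = 1%:M.
  have -> : int_mx R[i] B = map_mx (real_complex R) (int_mx R B).
    by apply/matrixP => p q; rewrite !mxE rmorph_int.
  by rewrite -map_mxM BN map_mx1.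
have vE : v = z *: (v *m NC) by rewrite scalemxAl -vB -mulmxA BNC mulmx1.
pose S := \sum_j modulus (v 0 j).
have modsum (I : finType) (F : I -> R[i]) : modulus (\sum_i F i) <= \sum_i modulus (F i).
  elim/big_ind2: _ => [|a b c d ab cd|//]; first by rewrite modulus0.
  by apply: le_trans (modulusD _ _) _; rewrite lerD.
have S0 : 0 < S.
  rewrite lt_def sumr_ge0 ?andbT => [|j _]; last exact: modulus_ge0.
  apply: contraNneq v0 => /psumr_eq0P vj; apply/eqP/rowP => j.
  have /(congr1 (real_complex R)) : modulus (v 0 j) = 0.
    by apply: vj => // k _; exact: modulus_ge0.
  by rewrite modulusE rmorph0 mxE => /eqP; rewrite normr_eq0 => /eqP.
have : S <= modulus z * (S / 4).
  have colj j : modulus (v 0 j) <= modulus z * (S * (4 * n%:R)^-1).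
    rewrite [in leLHS]vE mxE modulusM ler_wpM2l ?modulus_ge0// mxE.
    apply: le_trans (modsum _ _) _; rewrite mulr_suml; apply: ler_sum => i _.
    by rewrite modulusM mxE modulus_real ler_wpM2l ?modulus_ge0.
  apply: le_trans (ler_sum _ (fun j _ => colj j)) _.
  rewrite sumr_const card_ord.
  suff -> : (modulus z * (S * (4 * n%:R)^-1)) *+ n = modulus z * (S / 4) by [].
  rewrite -mulr_natl; move: (n%:R : R) nR => m m0.
  by field; rewrite gt_eqF.
rewrite -modulus_gt1 mulrC -mulrA -[leLHS]mulr1 ler_pM2l//.
have := modulus_ge0 z; lra.
Qed.

Lemma dilation_power_contracting n (A : 'M[int]_n) : (0 < n)%N ->
  dilation_matrix R A -> exists2 beta : nat, (1 <= beta)%N &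
  forall k, (beta <= k)%N -> dilation_matrix R (A ^+ k) /\
    exists N, contracting_inverse (R := R) (A ^+ k) N.
Proof.
case: n A => // n A _ dA; have uA := dilation_unit dA.
pose N := (int_mx R A)^-1.
have e0 : 0 < (4 * n.+1%:R)^-1 :> R by rewrite invr_gt0 mulr_gt0.
have [K HK] : exists K, forall k, (K <= k)%N -> forall i j,
    `|(N ^+ k) i j| <= (4 * n.+1%:R)^-1.
  suff /choice[f Hf] : forall ij : 'I_n.+1 * 'I_n.+1, exists K, forall k, (K <= k)%N ->
      `|(N ^+ k) ij.1 ij.2| <= (4 * n.+1%:R)^-1.
    exists (\max_ij f ij)%N => k kK i j; apply: (Hf (i, j)).
    exact: leq_trans (leq_bigmax _) kK.
  move=> [i j]; have /cvgrPdist_le/(_ _ e0)[K _ HK] := dilation_inverse_cvg dA i j.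
  by exists K => k /HK; rewrite /= sub0r normrN.
exists (maxn 1 K); first exact: leq_maxl.
move=> k; rewrite geq_max => /andP[_ /HK Nk].
have BN : int_mx R (A ^+ k) *m N ^+ k = 1%:M.
  have -> : int_mx R (A ^+ k) = int_mx R A ^+ k by rewrite /int_mx rmorphXn.
  by rewrite mulmxE /N exprVn divrr ?unitrX.
split; first exact: contracting_inverse_dilation BN Nk.
by exists (N ^+ k); exact: contracting_inverse_small.
Qed.

End spectral.

(** * Square-integrable functions *)
Section sqmod.
Context {R : realType}.
Implicit Types z w : R[i].

Definition sqmod z : R := complex.Re z ^+ 2 + complex.Im z ^+ 2.

Lemma sqmod_ge0 z : 0 <= sqmod z.
Proof. by rewrite addr_ge0 ?sqr_ge0. Qed.

Lemma sqmod0 : sqmod 0 = 0.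
Proof. by rewrite /sqmod /= expr0n addr0. Qed.

Lemma sqmod_eq0 z : sqmod z = 0 -> z = 0.
Proof.
move=> /eqP; rewrite paddr_eq0 ?sqr_ge0// !sqrf_eq0 => /andP[/eqP a0 /eqP b0].
by apply/eqP; rewrite eq_complex a0 b0 !eqxx.
Qed.

Lemma sqmodN z : sqmod (- z) = sqmod z.
Proof. by case: z => a b; rewrite /sqmod /= !sqrrN. Qed.

Lemma sqmodM z w : sqmod (z * w) = sqmod z * sqmod w.
Proof. by case: z w => a b [c d]; rewrite /sqmod /=; ring. Qed.

Lemma sqmodD z w : sqmod (z + w) <= 2 * (sqmod z + sqmod w).
Proof.
case: z w => a b [c d]; rewrite /sqmod /=.
have := sqr_ge0 (a - c); have := sqr_ge0 (b - d); lra.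
Qed.

Lemma sqmod_real (x : R) : sqmod (x%:C)%C = x ^+ 2.
Proof. by rewrite /sqmod /= expr0n addr0. Qed.

Lemma sqmod_norm z : complex.Re `|z| ^+ 2 = sqmod z.
Proof. by rewrite normc_def /= sqr_sqrtr// addr_ge0 ?sqr_ge0. Qed.

End sqmod.

Section energy.
Context {R : realType} {n : nat}.
Notation la := (@lebesgue_cV R n).
Implicit Types (f g : 'cV[R]_n -> R[i]) (S : set ('cV[R]_n -> R[i])).

Lemma measurable_CfunD f g : measurable_Cfun f -> measurable_Cfun g ->
  measurable_Cfun (fun x => f x + g x).
Proof.
move=> [f1 f2] [g1 g2]; split.
  rewrite (_ : (fun x => _) = fun x => complex.Re (f x) + complex.Re (g x)).
    exact: measurable_funD.
  by apply/funext => x; case: (f x) (g x) => ? ? [].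
rewrite (_ : (fun x => _) = fun x => complex.Im (f x) + complex.Im (g x)).
  exact: measurable_funD.
by apply/funext => x; case: (f x) (g x) => ? ? [].
Qed.

Lemma measurable_CfunM f g : measurable_Cfun f -> measurable_Cfun g ->
  measurable_Cfun (fun x => f x * g x).
Proof.
move=> [f1 f2] [g1 g2]; split.
  rewrite (_ : (fun x => _) = fun x => complex.Re (f x) * complex.Re (g x) -
                                       complex.Im (f x) * complex.Im (g x)).
    by apply: measurable_funB; exact: measurable_funM.
  by apply/funext => x; case: (f x) (g x) => ? ? [].
rewrite (_ : (fun x => _) = fun x => complex.Re (f x) * complex.Im (g x) +
                                     complex.Im (f x) * complex.Re (g x)).
  by apply: measurable_funD; exact: measurable_funM.
by apply/funext => x; case: (f x) (g x) => ? ? [].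
Qed.

Lemma measurable_Cfun_cst c : measurable_Cfun (fun _ : 'cV[R]_n => c).
Proof. by split; exact: measurable_cst. Qed.

Lemma measurable_Cfun_real (h : 'cV[R]_n -> R) :
  measurable_fun setT h -> measurable_Cfun (fun x => (h x)%:C)%C.
Proof. by move=> mh; split => //=; exact: measurable_cst. Qed.

Lemma measurable_CfunB f g : measurable_Cfun f -> measurable_Cfun g ->
  measurable_Cfun (fun x => f x - g x).
Proof.
move=> mf mg; rewrite (_ : (fun x => _) = fun x => f x + (- 1) * g x).
  by apply: measurable_CfunD => //; apply: measurable_CfunM.
by apply/funext => x; rewrite mulN1r.
Qed.

Lemma measurable_Cfun_comp f (u : 'cV[R]_n -> 'cV[R]_n) :
  measurable_fun setT u -> measurable_Cfun f -> measurable_Cfun (f \o u).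
Proof.
by move=> mu [f1 f2]; split; [exact: (measurableT_comp f1 mu)|exact: (measurableT_comp f2 mu)].
Qed.

Lemma measurable_sqmod f : measurable_Cfun f ->
  measurable_fun setT (fun x => sqmod (f x)).
Proof. by case=> f1 f2; apply: measurable_funD; exact: measurable_funX. Qed.

Definition energy f : \bar R := (\int[la]_x (sqmod (f x))%:E)%E.

Lemma energy_ge0 f : (0 <= energy f)%E.
Proof. by apply: integral_ge0 => x _; rewrite lee_fin sqmod_ge0. Qed.

Lemma L2norm_sqr f : (L2norm f `^ 2 = energy f)%E.
Proof.
rewrite /L2norm powR_Lnorm//; apply: eq_integral => x _.
rewrite -[LHS]/(((`|complex.Re `|f x| |)%:E `^ 2)%E) poweR_EFin powR_mulrn//; congr EFin.
by rewrite -normrX ger0_norm ?sqr_ge0// sqmod_norm.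
Qed.

Lemma L2norm_lt f e : 0 < e -> (L2norm f < e%:E)%E = (energy f < (e ^+ 2)%:E)%E.
Proof.
move=> e0; rewrite -L2norm_sqr; have : (0 <= L2norm f)%E by exact: Lnorm_ge0.
case: (L2norm f) => [r| |]//; last by rewrite poweRyr.
rewrite lee_fin => r0; rewrite poweR_EFin powR_mulrn// !lte_fin.
by rewrite ltr_pXn2r// ?nnegrE// ltW.
Qed.

Lemma L2norm_lty f : (L2norm f < +oo)%E = (energy f < +oo)%E.
Proof.
rewrite -L2norm_sqr; apply/idP/idP; first exact: poweR_lty.
exact: lty_poweRy.
Qed.

Lemma L2P f : L2 f <-> measurable_Cfun f /\ (energy f < +oo)%E.
Proof. by rewrite /L2 /= L2norm_lty. Qed.

Lemma L2closureP S f : L2closure S f <->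
  L2 f /\ forall e : R, 0 < e -> exists2 g, S g & (energy (fun x => (f x - g x)%R) < e%:E)%E.
Proof.
split=> -[L2f H]; split=> // e e0.
  have se0 : 0 < Num.sqrt e by rewrite sqrtr_gt0.
  have [g Sg] := H _ se0.
  by rewrite L2norm_lt// sqr_sqrtr ?ltW//; exists g.
have [g Sg H'] := H _ (exprn_gt0 2 e0).
by exists g => //; rewrite L2norm_lt.
Qed.

Lemma energy_le f g : measurable_Cfun f -> measurable_Cfun g ->
  (forall x, sqmod (f x) <= sqmod (g x)) -> (energy f <= energy g)%E.
Proof.
move=> mf mg fg; apply: ge0_le_integral => //.
- by move=> x _; rewrite lee_fin sqmod_ge0.
- by apply/measurable_EFinP; exact: measurable_sqmod.
- by apply/measurable_EFinP; exact: measurable_sqmod.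
- by move=> x _; rewrite lee_fin.
Qed.

Lemma eq_energy_ae f g : measurable_Cfun f -> measurable_Cfun g ->
  ae_equal f g -> energy f = energy g.
Proof.
move=> mf mg fg; apply: ge0_ae_eq_integral => //.
- by apply/measurable_EFinP; exact: measurable_sqmod.
- by apply/measurable_EFinP; exact: measurable_sqmod.
- by move=> x _; rewrite lee_fin sqmod_ge0.
- by move=> x _; rewrite lee_fin sqmod_ge0.
- by apply: filterS fg => x -> _.
Qed.

Lemma energyD f g : measurable_Cfun f -> measurable_Cfun g ->
  (energy (fun x => (f x + g x)%R) <= 2%:E * (energy f + energy g))%E.
Proof.
move=> mf mg; have msf := measurable_sqmod mf; have msg := measurable_sqmod mg.
rewrite /energy -ge0_integralD//; last 4 first.
- by move=> x _; rewrite lee_fin sqmod_ge0.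
- exact/measurable_EFinP.
- by move=> x _; rewrite lee_fin sqmod_ge0.
- exact/measurable_EFinP.
rewrite -ge0_integralZl//; last 2 first.
- by apply: emeasurable_funD; exact/measurable_EFinP.
- by move=> x _; rewrite adde_ge0// lee_fin sqmod_ge0.
apply: ge0_le_integral => //.
- by move=> x _; rewrite lee_fin sqmod_ge0.
- by apply/measurable_EFinP; apply: measurable_sqmod; exact: measurable_CfunD.
- by apply: measurable_funeM; apply: emeasurable_funD; exact/measurable_EFinP.
- by move=> x _; rewrite -EFinD -EFinM lee_fin sqmodD.
Qed.

Lemma energyZ c f : measurable_Cfun f ->
  energy (fun x => c * f x) = ((sqmod c)%:E * energy f)%E.
Proof.
move=> mf; rewrite /energy -ge0_integralZl//; last 3 first.
- by apply/measurable_EFinP; exact: measurable_sqmod.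
- by move=> x _; rewrite lee_fin sqmod_ge0.
- by rewrite lee_fin sqmod_ge0.
by apply: eq_integral => x _; rewrite sqmodM EFinM.
Qed.

Lemma L2_lin c f g : L2 f -> L2 g -> L2 (fun x => c * f x + g x).
Proof.
move=> /L2P[mf ef] /L2P[mg eg].
have mcf : measurable_Cfun (fun x => c * f x).
  exact: measurable_CfunM.
apply/L2P; split; first exact: measurable_CfunD.
apply: le_lt_trans (energyD mcf mg) _.
rewrite lte_mul_pinfty// lte_add_pinfty// energyZ//.
by rewrite lte_mul_pinfty ?lee_fin ?sqmod_ge0.
Qed.

Lemma L2_0 : L2 (fun _ : 'cV[R]_n => 0 : R[i]).
Proof.
apply/L2P; split; first exact: measurable_Cfun_cst.
by rewrite /energy integral0_eq// => x _; rewrite sqmod0.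
Qed.

(** Dominated convergence.  Truncations of f, and simple functions between 0 and
    f, leave an error dominated by f itself. *)
Lemma energy_approx f (g : nat -> 'cV[R]_n -> R[i]) : L2 f ->
  (forall m, measurable_Cfun (g m)) ->
  {ae la, forall x m, sqmod (f x - g m x) <= sqmod (f x)} ->
  {ae la, forall x, (fun m => sqmod (f x - g m x)) @ \oo --> (0 : R)} ->
  forall e : R, 0 < e ->
    exists m, (energy (fun x => (f x - g m x)%R) < e%:E)%E.
Proof.
move=> /L2P[mf ef] mg dom cvg e e0.
have mfg m : measurable_fun setT (fun x => sqmod (f x - g m x)).
  by apply: measurable_sqmod; exact: measurable_CfunB.
have msf := measurable_sqmod mf.
have isf : la.-integrable setT (fun x => (sqmod (f x))%:E).
  apply/integrableP; split; first exact/measurable_EFinP.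
  by under eq_integral do rewrite abse_EFin ger0_norm ?sqmod_ge0//.
have hc : {ae la, forall x, setT x ->
    (fun m => (sqmod (f x - g m x))%:E) @ \oo --> (cst 0%E x : \bar R)}.
  by apply: filterS cvg => x cx _; apply/fine_cvgP; split; [exact: nearW|exact: cx].
have hd : {ae la, forall x m, setT x ->
    (`|(sqmod (f x - g m x)%R)%:E| <= (sqmod (f x))%:E)%E}.
  by apply: filterS dom => x dx m _; rewrite abse_EFin ger0_norm ?sqmod_ge0 ?lee_fin.
have [_ _ H] := dominated_convergence measurableT
  (fun m => (measurable_EFinP _ _).2 (mfg m)) (measurable_cst _) hc isf hd.
rewrite integral0 in H.
apply: contrapT => /forallNP H'.
have : (e%:E <= limn (fun m => energy (fun x => (f x - g m x)%R)))%E.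
  apply: lime_ge; first by apply/cvg_ex; exists 0%E.
  by apply: nearW => m; rewrite leNgt; apply/negP; exact: H'.
by rewrite (cvg_lim _ H)// leNgt lte_fin e0.
Qed.

End energy.

Section cindic.
Context {R : realType} {n : nat}.
Notation la := (@lebesgue_cV R n).
Implicit Types (f g : 'cV[R]_n -> R[i]) (E F : set 'cV[R]_n).

Definition cindic E : 'cV[R]_n -> R[i] := fun x => (((\1_E x : R))%:C)%C.

Lemma cindicT E x : E x -> cindic E x = 1.
Proof. by move=> Ex; rewrite /cindic indicE mem_set. Qed.

Lemma cindicF E x : ~ E x -> cindic E x = 0.
Proof. by move=> Ex; rewrite /cindic indicE memNset. Qed.

Lemma measurable_cindic E : measurable E -> measurable_Cfun (cindic E).
Proof. by move=> mE; apply: measurable_Cfun_real; exact: measurable_indic. Qed.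

Lemma sqmod_cindic E x : sqmod (cindic E x) = \1_E x.
Proof. by rewrite sqmod_real indicE; case: (_ \in _); rewrite ?expr1n ?expr0n. Qed.

Lemma energy_cindic E : measurable E -> energy (cindic E) = la E.
Proof.
move=> mE; rewrite /energy; under eq_integral do rewrite sqmod_cindic.
by rewrite integral_indic// setIT.
Qed.

Lemma L2_cindic E : measurable E -> (la E < +oo)%E -> L2 (cindic E).
Proof.
by move=> mE Efin; apply/L2P; split; [exact: measurable_cindic|rewrite energy_cindic].
Qed.

Lemma L2_mask E f : measurable E -> L2 f -> L2 (fun x => cindic E x * f x).
Proof.
move=> mE /L2P[mf ef]; have mEf : measurable_Cfun (fun x => cindic E x * f x).
  by apply: measurable_CfunM => //; exact: measurable_cindic.
apply/L2P; split => //; apply: le_lt_trans ef; apply: energy_le => // x.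
rewrite sqmodM sqmod_cindic indicE; case: (_ \in _); first by rewrite mul1r.
by rewrite mul0r sqmod_ge0.
Qed.

(** Truncations of f to sets that eventually contain almost every point of the
    support of f converge to f. *)
Lemma energy_mask_approx f (A : nat -> set 'cV[R]_n) : L2 f ->
  (forall m, measurable (A m)) ->
  {ae la, forall x, exists m0, forall m, (m0 <= m)%N -> A m x \/ f x = 0} ->
  forall e : R, 0 < e -> exists m,
    (energy (fun x => (f x - cindic (A m) x * f x)%R) < e%:E)%E.
Proof.
move=> L2f mA cov; have [mf _] := (L2P f).1 L2f; apply: energy_approx => //.
- by move=> m; apply: measurable_CfunM => //; exact: measurable_cindic.
- apply: aeW => x m; have [Ax|Ax] := pselect (A m x).
    by rewrite cindicT// mul1r subrr sqmod0 sqmod_ge0.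
  by rewrite cindicF// mul0r subr0.
- apply: filterS cov => x [m0 Hm0]; apply: cvg_near_cst.
  exists m0 => // m /= /Hm0[Ax|->]; last by rewrite mulr0 subrr sqmod0.
  by rewrite cindicT// mul1r subrr sqmod0.
Qed.

End cindic.

(** * Density of indicators of bounded open sets *)
Section density.
Context {R : realType} {n : nat}.
Notation la := (@lebesgue_cV R n).

(** Openness for the sup norm, stated with the closed balls [sup_ball]. *)
Definition sup_open (U : set 'cV[R]_n) : Prop :=
  forall x, U x -> exists2 r : R, 0 < r & forall y, sup_ball r (y - x) -> U y.

Lemma sup_openI U V : sup_open U -> sup_open V -> sup_open (U `&` V).
Proof.
move=> oU oV x [/oU[r r0 rU] /oV[s s0 sV]].
exists (Num.min r s); first by rewrite lt_min r0.
move=> y yx; split; [apply: rU|apply: sV]; apply: sup_ball_le yx.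
  by rewrite ge_min lexx.
by rewrite ge_min lexx orbT.
Qed.

Definition open_cube (c : R) : set 'cV[R]_n := [set x | forall i, `|x i ord0| < c].

Lemma open_cube_sup_ball c : open_cube c `<=` sup_ball c.
Proof. by move=> x xc i; exact: ltW. Qed.

Lemma measurable_open_cube c : measurable (open_cube c).
Proof.
rewrite (_ : open_cube c = \bigcap_(i in [set: 'I_n])
    ((fun v : 'cV[R]_n => v i ord0) @^-1` `]- c, c[)).
  apply: fin_bigcap_measurable => [|i _]; first exact: finite_finset.
  by apply: measurable_setT_preimage => //; exact: measurable_mx_coord.
by apply/seteqP; split=> x h i => [_|]; have := h i;
  rewrite /= in_itv/= ltr_norml //; exact.
Qed.

Lemma sup_open_cube c : sup_open (open_cube c).
Proof.
move=> x xc; have [r r0 rP] : exists2 r : R, 0 < r & forall i, r < c - `|x i ord0|.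
  pose m := \big[Num.min/1]_i (c - `|x i ord0|).
  have m0 : 0 < m.
    by apply: lt_bigmin => // i _; rewrite subr_gt0.
  exists (m / 2) => [|i]; first by rewrite divr_gt0.
  have : m <= c - `|x i ord0| by apply: bigmin_le_cond.
  lra.
exists r => // y yx i; have := yx i; have := rP i; rewrite !mxE.
rewrite -[y i ord0 in X in _ -> _ -> X](subrK (x i ord0)) => h1 h2.
by apply: le_lt_trans (ler_normD _ _) _; lra.
Qed.

(** The preimages of open half-lines under the coordinates are open and generate
    the Borel sets. *)
Lemma measurable_sup_open_generated :
  @measurable _ 'cV[R]_n = <<s [set U | measurable U /\ sup_open U] >>.
Proof.
set G := [set U | _]; apply/seteqP; split; last first.
  apply: smallest_sub; last by move=> U [].
  split => //=; [by move=> A mA; rewrite setTD; exact: measurableC|].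
  by move=> F mF; exact: bigcupT_measurable.
apply: smallest_sub; first exact: smallest_sigma_algebra.
move=> A [[i j] _ [Y mY <-]] /=; rewrite setTI.
pose T := g_sigma_algebraType G.
have mf : measurable_fun [set: T] (fun v : T => (v : 'cV[R]_n) i j).
  apply: (measurability _ (RGenOInfty.measurableE R)).
  move=> _ [_ [x ->] <-]; rewrite setTI; apply: sub_sigma_algebra; split.
    by apply: measurable_setT_preimage; [exact: measurable_mx_coord|exact: measurable_itv].
  move=> v /=; rewrite in_itv/= andbT => xv; exists ((v i j - x) / 2).
    by rewrite divr_gt0// subr_gt0.
  move=> y /(_ i); rewrite !mxE (ord1 j) in_itv/= andbT ler_norml.
  by rewrite (ord1 j) in xv *; lra.
by have := mf measurableT Y mY; rewrite setTI.
Qed.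

Record L2closed_subspace (S : set ('cV[R]_n -> R[i])) : Prop := {
  L2closed_sub : S `<=` L2;
  L2closed_0 : S (fun=> 0);
  L2closed_lin : forall c f g, S f -> S g -> S (fun x => c * f x + g x);
  L2closed_lim : forall f, L2 f -> (forall e : R, 0 < e ->
    exists2 g, S g & (energy (fun x => (f x - g x)%R) < e%:E)%E) -> S f }.

Variable S : set ('cV[R]_n -> R[i]).
Hypothesis S_closed : L2closed_subspace S.
Hypothesis S_open : forall U c, measurable U -> sup_open U -> U `<=` sup_ball c ->
  S (cindic U).

Lemma L2closed_sum (I : eqType) (s : seq I) (c : I -> R[i]) F :
  (forall i, i \in s -> S (F i)) -> S (fun x => \sum_(i <- s) c i * F i x).
Proof.
elim: s => [_|i s IH H].
  under eq_fun do rewrite big_nil; exact: L2closed_0.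
under eq_fun do rewrite big_cons.
apply: (L2closed_lin S_closed); first by apply: H; rewrite mem_head.
by apply: IH => j js; apply: H; rewrite inE js orbT.
Qed.

Lemma lebesgue_bounded_fin U c : measurable U -> U `<=` sup_ball c -> (la U < +oo)%E.
Proof.
move=> mU Uc; apply: le_lt_trans (lebesgue_sup_ball_fin c).
by apply: le_measure => //; rewrite inE//; exact: measurable_sup_ball.
Qed.

(** Dynkin's theorem, localised to a cube so that complements keep a finite
    measure. *)
Lemma L2closed_measurable c E : measurable E -> S (cindic (E `&` open_cube c)).
Proof.
set K := open_cube c; have mK : measurable K by exact: measurable_open_cube.
have SK : S (cindic K).
  by apply: S_open => //; [exact: sup_open_cube|exact: open_cube_sup_ball].
have fin F : measurable F -> L2 (cindic (F `&` K)).
  move=> mF; apply: L2_cindic; first exact: measurableI.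
  apply: (@lebesgue_bounded_fin _ c); first exact: measurableI.
  by move=> x [_ /open_cube_sup_ball].
move=> mE; apply: (dynkin_induction (P := fun E => S (cindic (E `&` K)))
  measurable_sup_open_generated).
- by move=> U V [mU oU] [mV oV]; split; [exact: measurableI|exact: sup_openI].
- by rewrite setTI.
- move=> U [mU oU]; apply: (S_open (c := c)); first exact: measurableI.
    by apply: sup_openI => //; exact: sup_open_cube.
  by move=> x [_ /open_cube_sup_ball].
- move=> F mF SF; rewrite (_ : cindic _ = fun x => (- 1) * cindic (F `&` K) x + cindic K x).
    exact: L2closed_lin.
  apply/funext => x; have [Kx|Kx] := pselect (K x); last first.
    by rewrite !cindicF ?mulr0 ?addr0// => -[].
  rewrite (cindicT Kx); have [Fx|Fx] := pselect (F x).
    by rewrite cindicF ?cindicT ?mulr1 ?addNr// => -[].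
  by rewrite cindicT ?cindicF ?mulr0 ?add0r// => -[].
- move=> F mF tF SF.
  (* The indicator of the union is the limit of those of finite unions. *)
  pose U m := [set x | exists2 i, (i < m)%N & F i x].
  have mU m : measurable (U m).
    rewrite (_ : U m = \bigcup_(i in [set i | (i < m)%N]) F i).
      by apply: bigcup_measurable.
    by apply/seteqP; split=> x [i im Fx]; exists i.
  have SU m : S (cindic (U m `&` K)).
    elim: m => [|m IH].
      rewrite (_ : cindic _ = fun=> 0); first exact: L2closed_0.
      by apply/funext => x; rewrite cindicF// => -[[]].
    rewrite (_ : cindic _ = fun x => 1 * cindic (U m `&` K) x + cindic (F m `&` K) x).
      exact: L2closed_lin.
    apply/funext => x; rewrite mul1r; have [Kx|Kx] := pselect (K x); last first.
      by rewrite !cindicF ?addr0// => -[].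
    have [Fx|Fx] := pselect (F m x).
      rewrite cindicT; last by split=> //; exists m.
      rewrite cindicF ?add0r ?cindicT// => -[[i im Fi] _].
      have /seteqP[/(_ x) + _] : F i `&` F m = set0.
          by apply: (trivIsetP.1 tF) => //; rewrite neq_ltn im.
      by apply.
    have [Ux|Ux] := pselect (U m x).
      rewrite (@cindicF _ _ (F m `&` K)) ?addr0; last by case.
      rewrite !cindicT//; split=> //.
      by have [i im Fi] := Ux; exists i => //; exact: leqW.
    rewrite !cindicF ?addr0//; try by case.
    move=> [[i im Fi] _]; move: im; rewrite ltnS leq_eqVlt => /orP[/eqP iE|im].
      by apply: Fx; rewrite -iE.
    by apply: Ux; exists i.
  apply: (L2closed_lim S_closed); first by apply: fin; exact: bigcupT_measurable.
  move=> e e0; have mF' : measurable (\bigcup_k F k) by exact: bigcupT_measurable.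
  have [|m Hm] := energy_mask_approx (fin _ mF') mU _ e0.
    apply: aeW => x; have [[[i _ Fi] _]|nF] := pselect ((\bigcup_k F k `&` K) x).
      by exists i.+1 => m im; left; exists i.
    by exists 0%N => m _; right; rewrite cindicF.
  exists (cindic (U m `&` K)) => //; apply: le_lt_trans Hm; rewrite le_eqVlt; apply/orP; left.
  apply/eqP; congr energy; apply/funext => x; congr (_ - _).
  have [Ux|Ux] := pselect (U m x); last by rewrite (cindicF Ux) mul0r cindicF// => -[].
  rewrite (cindicT Ux) mul1r; have [Kx|Kx] := pselect (K x); last first.
    by rewrite !cindicF// => -[].
  by rewrite !cindicT//; split=> //; have [i _ Fi] := Ux; exists i.
- by rewrite -measurable_sup_open_generated.
Qed.

Lemma open_cube_exhaust (x : 'cV[R]_n) :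
  exists m0, forall m, (m0 <= m)%N -> open_cube m%:R x.
Proof.
pose c := \big[Num.max/0]_i `|x i ord0|.
exists (Num.truncn c).+1 => m cm i; apply: (@lt_le_trans _ _ (Num.truncn c).+1%:R).
  by apply: le_lt_trans (truncnS_gt c); apply: le_bigmax_cond.
by rewrite ler_nat.
Qed.

Import HBNNSimple.

(** Approximate h from below by simple functions, each cut off to a cube: these
    are combinations of indicators of bounded Borel sets, and they are dominated
    by h. *)
Lemma L2closed_nonneg (h : 'cV[R]_n -> R) : measurable_fun setT h ->
  (forall x, 0 <= h x) -> L2 (fun x => (h x)%:C)%C -> S (fun x => (h x)%:C)%C.
Proof.
move=> mh h0 L2h.
have mEh : measurable_fun setT (EFin \o h) by exact/measurable_EFinP.
pose s := nnsfun_approx measurableT mEh.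
have sh x : (fun m => s m x) @ \oo --> h x.
  have := @cvg_nnsfun_approx _ _ _ _ measurableT _ mEh
    (fun x _ => (h0 x : (0 <= (h x)%:E)%E)) x I.
  by move/fine_cvgP => [].
have sle m x : s m x <= h x.
  have nd : nondecreasing_seq (fun m => s m x).
    by move=> p q pq; have /lefP := nd_nnsfun_approx measurableT mEh pq; exact.
  have := nondecreasing_cvgn_le nd (cvgP _ (sh x)) m.
  by rewrite (cvg_lim _ (sh x)).
pose g m x : R[i] := cindic (open_cube m%:R) x * ((s m x)%:C)%C.
have mg m : measurable_Cfun (g m).
  apply: measurable_CfunM; first by apply: measurable_cindic; exact: measurable_open_cube.
  by apply: measurable_Cfun_real; exact: measurable_funP.
have Sg m : S (g m).
  have fin : finite_set (range (s m)) by exact: fimfunP.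
  rewrite (_ : g m = fun x => \sum_(y <- finmap.enum_fset (fset_set (range (s m))))
      (y%:C)%C * cindic (s m @^-1` [set y] `&` open_cube m%:R) x).
    apply: L2closed_sum => y _; apply: L2closed_measurable.
    by rewrite -[X in measurable X]setTI; exact: measurable_funP.
  apply/funext => x; rewrite /g fimfunE fsbig_finite//= rmorph_sum/= mulr_sumr.
  apply: eq_bigr => y _; rewrite rmorphM/= mulrCA; congr (_ * _).
  have [Kx|Kx] := pselect (open_cube m%:R x); last first.
    by rewrite (cindicF Kx) mul0r cindicF// => -[].
  rewrite (cindicT Kx) mul1r.
  have [yx|yx] := pselect ((s m @^-1` [set y]) x).
    by rewrite cindicT// indicE mem_set.
  by rewrite cindicF ?indicE ?memNset// => -[].
apply: (L2closed_lim S_closed) => // e e0.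
have [||m Hm] := energy_approx L2h mg _ _ e0; last by exists (g m).
  apply: aeW => x m; rewrite /g.
  have [Kx|Kx] := pselect (open_cube m%:R x); last first.
    by rewrite (cindicF Kx) mul0r subr0.
  rewrite (cindicT Kx) mul1r -rmorphB/= !sqmod_real.
  have := sle m x; have : 0 <= s m x by [].
  by move=> s0 sx; rewrite ler_pXn2r// ?nnegrE ?subr_ge0//; lra.
apply: aeW => x; have [m0 Hm0] := open_cube_exhaust x.
have hs : (fun m => h x - s m x) @ \oo --> h x - h x.
  by apply: cvgB; [exact: cvg_cst|exact: sh].
have hh : (fun m => (h x - s m x) * (h x - s m x)) @ \oo --> (0 : R).
  by have -> : (0 : R) = (h x - h x) * (h x - h x); [rewrite subrr mulr0|exact: cvgM].
apply: (cvg_trans _ hh); apply: near_eq_cvg.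
exists m0 => // m /= /Hm0 Kx.
by rewrite /g (cindicT Kx) mul1r -rmorphB/= sqmod_real expr2.
Qed.

Lemma L2closed_dense : L2 `<=` S.
Proof.
move=> f L2f; have /L2P[[mr mi] ef] := L2f.
have pos (u : 'cV[R]_n -> R) : measurable_fun setT u ->
    (forall x, u x ^+ 2 <= sqmod (f x)) -> S (fun x => (Num.max (u x) 0)%:C)%C.
  move=> mu uf; have mu0 : measurable_fun setT (fun x => Num.max (u x) 0).
    by apply: measurable_maxr => //; exact: measurable_cst.
  apply: L2closed_nonneg => //; first by move=> x; rewrite le_max lexx orbT.
  apply/L2P; split; first exact: measurable_Cfun_real.
  apply: le_lt_trans ef; apply: energy_le => //.
  move=> x; rewrite sqmod_real; apply: le_trans (uf x).
  by case: (leP (u x) 0) => _; rewrite ?expr0n ?sqr_ge0 ?lexx.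
have real (u : 'cV[R]_n -> R) : measurable_fun setT u ->
    (forall x, u x ^+ 2 <= sqmod (f x)) -> S (fun x => (u x)%:C)%C.
  move=> mu uf.
  rewrite (_ : (fun x => _) = fun x => (- 1) * ((Num.max (- u x) 0)%:C)%C +
      ((Num.max (u x) 0)%:C)%C).
    apply: (L2closed_lin S_closed); apply: pos => //.
      exact: measurableT_comp.
    by move=> x; rewrite sqrrN.
  apply/funext => x; rewrite mulN1r -rmorphN -rmorphD/=; congr (_%:C)%C.
  by case: (leP (u x)); case: (leP (- u x)); lra.
rewrite (_ : f = fun x => ('i)%C * ((complex.Im (f x))%:C)%C + ((complex.Re (f x))%:C)%C).
  apply: (L2closed_lin S_closed); apply: real => // x; rewrite /sqmod.
    by rewrite lerDr sqr_ge0.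
  by rewrite lerDl sqr_ge0.
by apply/funext => x; rewrite addrC; exact: complexE.
Qed.

End density.

(** * Functions constant on the cells of a tiling *)
Section change_of_variables.
Context {R : realType} {n : nat}.
Notation la := (@lebesgue_cV R n).
Implicit Types (f g : 'cV[R]_n -> R[i]).

Lemma energy_comp f (u : 'cV[R]_n -> 'cV[R]_n) (c : R) :
  measurable_fun setT u -> 0 <= c ->
  (forall E, measurable E -> la [set x | E (u x)] = (c%:E * la E)%E) ->
  measurable_Cfun f -> energy (f \o u) = (c%:E * energy f)%E.
Proof.
move=> mu c0 uE mf; rewrite /energy.
have msf : measurable_fun setT (fun x => (sqmod (f x))%:E).
  by apply/measurable_EFinP; exact: measurable_sqmod.
transitivity (\int[pushforward la u]_x (sqmod (f x))%:E)%E.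
  rewrite ge0_integral_pushforward ?preimage_setT//.
  by move=> x _; rewrite lee_fin sqmod_ge0.
transitivity (\int[mscale (NngNum c0) la]_x (sqmod (f x))%:E)%E.
  by apply: eq_measure_integral => E mE _; exact: uE.
by rewrite ge0_integral_mscale// => x _; rewrite lee_fin sqmod_ge0.
Qed.

Lemma ae_comp (u : 'cV[R]_n -> 'cV[R]_n) (X : 'cV[R]_n -> Prop) :
  measurable_fun setT u ->
  (forall E, measurable E -> la E = 0%E -> la [set x | E (u x)] = 0%E) ->
  {ae la, forall x, X x} -> {ae la, forall x, X (u x)}.
Proof.
move=> mu uE [Z [mZ Z0 XZ]]; exists [set x | Z (u x)]; split.
- exact: measurable_setT_preimage.
- exact: uE.
- by move=> x Xux; exact: XZ.
Qed.

Lemma ae_linear (P N : 'M[R]_n) (X : 'cV[R]_n -> Prop) : P *m N = 1%:M ->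
  {ae la, forall x, X x} -> {ae la, forall x, X (P *m x)}.
Proof.
move=> PN; apply: ae_comp; first exact: measurable_mulmx.
by move=> E mE E0; rewrite (lebesgue_linear PN)// E0 mule0.
Qed.

Lemma ae_translate (t : 'cV[R]_n) (X : 'cV[R]_n -> Prop) :
  {ae la, forall x, X x} -> {ae la, forall x, X (x + t)}.
Proof.
apply: ae_comp; first exact: measurable_trans.
by move=> E mE E0; rewrite lebesgue_cV_translate.
Qed.

Lemma L2_translate k f : L2 f -> L2 (translate k f).
Proof.
move=> /L2P[mf ef]; have mt := measurable_trans (- int_mx R k : 'cV[R]_n).
apply/L2P; split; first exact: measurable_Cfun_comp mt mf.
rewrite (energy_comp (c := 1)) ?mul1e// => E mE.
by rewrite mul1e; exact: lebesgue_cV_translate.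
Qed.

End change_of_variables.

Section tile_space.
Context {R : realType} {n : nat} (B : 'M[int]_n) (N : 'M[R]_n).
Hypothesis BN : contracting_inverse B N.
Local Notation ir := (int_mx R).
Local Notation M := (int_mx R B).
Notation la := (@lebesgue_cV R n).
Local Notation T := (tile B N).
Implicit Types (f g : 'cV[R]_n -> R[i]) (P : 'M[R]_n).

(** The cells are the preimages under P of the translates of the tile; for P = B^j
    this is the space V_j. *)
Definition tile_space P : set ('cV[R]_n -> R[i]) :=
  [set f | L2 f /\ exists c : 'cV[int]_n -> R[i],
    {ae la, forall x k, T (P *m x - ir k) -> f x = c k}].

Lemma tile_space_subspace P : L2subspace (tile_space P).
Proof.
split.
- by move=> f [].
- move=> f g [_ [c fc]] L2g fg; split=> //; exists c.
  by apply: filterS2 fc fg => x + <-.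
- split; first exact: L2_0.
  by exists (fun=> 0); apply: aeW.
- move=> a f g [L2f [c fc]] [L2g [d gd]]; split; first exact: L2_lin.
  exists (fun k => a * c k + d k); apply: filterS2 fc gd => x fc gd k Tk.
  by rewrite (fc k)// (gd k).
Qed.

(** The cell of index d + B z for B P is contained in the cell of index z for P. *)
Lemma tile_space_nested P : tile_space P `<=` tile_space (M *m P).
Proof.
move=> f [L2f [c fc]]; split => //.
have /choice[z zP] l : exists z, exists2 d, d \in digits B N & l = d + B *m z.
  by have [d dD [z lE]] := digit_decomposition BN l; exists z, d.
exists (c \o z); apply: filterS fc => x fx l Tl; apply: fx.
have [d dD lE] := zP l; apply/(tile_refine BN); exists d => //.
by move: Tl; rewrite {1}lE int_mxD int_mxM mulmxBr mulmxA opprD addrA addrAC.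
Qed.

Lemma linear_scale_fin : linear_scale M \is a fin_num.
Proof.
rewrite ge0_fin_numE; last exact: measure_ge0.
have mQ := @measurable_half_open_cube R n.
apply: le_lt_trans (lebesgue_sup_ball_fin 1); apply: le_measure; rewrite ?inE.
- by apply: measurable_setT_preimage mQ; exact: measurable_mulmx.
- exact: measurable_sup_ball.
- move=> x /half_open_cube_sup_ball/(contr_sup_ball BN); rewrite contrK//.
  by apply: sup_ball_le; lra.
Qed.

Lemma L2_dilate f : L2 f -> L2 (dilate B f).
Proof.
move=> /L2P[mf ef]; have mM := measurable_mulmx M.
apply/L2P; split; first exact: measurable_Cfun_comp mM mf.
rewrite (energy_comp (c := fine (linear_scale M)))//.
- by rewrite lte_mul_pinfty// lee_fin fine_ge0//; exact: measure_ge0.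
- by rewrite fine_ge0//; exact: measure_ge0.
- by move=> E mE; rewrite fineK ?linear_scale_fin// (lebesgue_linear (contr_mulmxV BN)).
Qed.

Lemma tile_space_dilate P f : L2 f ->
  tile_space P f <-> tile_space (P *m M) (dilate B f).
Proof.
move=> L2f; split=> -[_ [c fc]].
  split; first exact: L2_dilate.
  exists c; apply: filterS (ae_linear (contr_mulmxV BN) fc) => x fx k Tk.
  by apply: fx; rewrite mulmxA.
split => //; exists c; apply: filterS (ae_linear (contr_mulVmx BN) fc) => x fx k Tk.
rewrite -(fx k); first by rewrite /dilate contrVK.
by rewrite -mulmxA contrVK.
Qed.

Lemma tile_space_translate k f : L2 f ->
  tile_space 1%:M f <-> tile_space 1%:M (translate k f).
Proof.
move=> L2f; split=> -[_ [c fc]].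
  split; first exact: L2_translate.
  exists (fun l => c (l - k)); apply: filterS (ae_translate (- ir k) fc) => x fx l Tl.
  by apply: fx; move: Tl; rewrite !mul1mx int_mxB opprB addrA subrK.
split => //; exists (fun l => c (l + k)).
apply: filterS (ae_translate (ir k) fc) => x fx l Tl.
rewrite -(fx (l + k)); first by rewrite /translate addrK.
by move: Tl; rewrite !mul1mx int_mxD opprD addrACA subrr addr0.
Qed.

Lemma expr_mulmx_iter m (x : 'cV[R]_n) : N ^+ m *m x = iter m (mulmx N) x.
Proof. by elim: m => [|m IH] /=; [rewrite mul1mx|rewrite exprS -mulmxE -mulmxA IH]. Qed.

(** A cell has measure at least (size digits)^m, and f is constant on it. *)
Lemma tile_space_value_bound m f : tile_space (N ^+ m) f ->
  {ae la, forall x, (((size (digits B N) ^ m)%N%:R * sqmod (f x))%R%:E <= energy f)%E}.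
Proof.
move=> [L2f [c fc]]; have mT := measurable_tile B N.
suff bnd k : (((size (digits B N) ^ m)%N%:R * sqmod (c k))%:E <= energy f)%E.
  apply: filterS fc => x fx; have [k Tk] := tile_cover BN (N ^+ m *m x).
  by rewrite (fx k).
pose C := [set x : 'cV[R]_n | shift_set T k (iter m (mulmx N) x)].
have [mC lC] := lebesgue_linear_iter BN m (measurable_shift_set k mT).
have [mf ef] := (L2P f).1 L2f.
have mCC := @measurable_cindic R n _ mC.
have -> : ((size (digits B N) ^ m)%N%:R * sqmod (c k))%:E =
  ((size (digits B N) ^ m)%N%:R%:E * (sqmod (c k))%:E)%E by rewrite EFinM.
apply: (@le_trans _ _ (la C * (sqmod (c k))%:E)%E).
  apply: lee_wpmul2r; first by rewrite lee_fin sqmod_ge0.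
  rewrite /C lC lebesgue_shift_set// (lebesgue_tile BN) mule1.
  exact: size_digits_expn_le.
rewrite muleC -energy_cindic// -energyZ//.
rewrite (@eq_energy_ae _ _ _ (fun x => cindic C x * f x)).
- apply: energy_le => //; first exact: measurable_CfunM.
  move=> x; rewrite sqmodM sqmod_cindic indicE; case: (_ \in _).
    by rewrite mul1r.
  by rewrite mul0r sqmod_ge0.
- exact: measurable_CfunM.
- exact: measurable_CfunM.
- apply: filterS fc => x fx; have [Cx|Cx] := pselect (C x).
    by rewrite cindicT// mulr1 mul1r (fx k)// expr_mulmx_iter.
  by rewrite cindicF// mulr0 mul0r.
Qed.

Lemma tile_space_bigcap0 f : (0 < n)%N -> (forall m, tile_space (N ^+ m) f) ->
  ae_equal f (fun=> 0).
Proof.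
move=> n0 Vf; have [mf ef] : measurable_Cfun f /\ (energy f < +oo)%E.
  by apply/L2P; have [] := Vf 0%N.
have := ae_foralln (fun m => tile_space_value_bound (Vf m)).
apply: filterS => x Hx; apply: sqmod_eq0.
have Efin : energy f \is a fin_num by rewrite ge0_fin_numE// energy_ge0.
have {}Hx m : m%:R * sqmod (f x) <= fine (energy f).
  have := Hx m; rewrite -{1}(fineK Efin) lee_fin; apply: le_trans.
  rewrite ler_wpM2r ?sqmod_ge0// ler_nat; apply: leq_trans (ltnW (ltn_expl m (_ : 1 < 2)%N)) _ => //.
  by case: m => // m; rewrite leq_exp2r//; exact: size_digits_ge2.
apply/eqP; rewrite eq_le sqmod_ge0 andbT leNgt; apply/negP => s0.
have := Hx (Num.truncn (fine (energy f) / sqmod (f x))).+1.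
by rewrite -ler_pdivlMr// leNgt truncnS_gt.
Qed.

(** Choose approximations g_i with summable squared errors.  Then g_i tends to f
    almost everywhere; as each g_i is constant on a cell, so is f on the points of
    convergence of that cell. *)
Lemma tile_space_closed P f : L2 f -> (forall e : R, 0 < e ->
    exists2 g, tile_space P g & (energy (fun x => (f x - g x)%R) < e%:E)%E) ->
  tile_space P f.
Proof.
move=> L2f app; split=> //; have [mf _] := (L2P f).1 L2f.
have eps i : 0 < (1 / (2 ^ i.+1)%:R : R) by rewrite divr_gt0// ltr0n expn_gt0.
have /choice[g gP] i : exists g, tile_space P g /\
    (energy (fun x => (f x - g x)%R) < (1 / (2 ^ i.+1)%:R)%:E)%E.
  by have [g Vg eg] := app _ (eps i); exists g.
have /choice[c cP] i : exists c, {ae la, forall x k, T (P *m x - ir k) -> g i x = c k}.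
  by have [[]] := gP i.
pose a i x := sqmod (f x - g i x).
have ma i : measurable_fun setT (fun x => (a i x)%:E).
  apply/measurable_EFinP; apply: measurable_sqmod; apply: measurable_CfunB => //.
  by have [[/L2P[]]] := gP i.
have a0 i x : setT x -> (0 <= (a i x)%:E)%E by rewrite lee_fin sqmod_ge0.
have sumfin : (\int[la]_x \sum_(i <oo) (a i x)%:E < +oo)%E.
  rewrite integral_nneseries//; apply: (@le_lt_trans _ _ 1%E); last exact: ltry.
  apply: le_trans (epsilon_trick0 (fun=> true) ler01).
  apply: lee_nneseries => i; first by move=> _ _; exact: energy_ge0.
  by have [_ /ltW] := gP i.
have aeconv : {ae la, forall x, (fun i => a i x) @ \oo --> (0 : R)}.
  have int : la.-integrable setT (fun x => (\sum_(i <oo) (a i x)%:E)%E).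
    apply/integrableP; split.
      by apply: ge0_emeasurable_sum => [i x Dx _|i _]; [exact: a0|exact: ma].
    rewrite (eq_integral (fun x => \sum_(i <oo) (a i x)%:E)%E)// => x _.
    by rewrite gee0_abs//; apply: nneseries_ge0 => i _ _; exact: a0.
  apply: filterS (integrable_ae measurableT int) => x /(_ I) fx.
  apply: (@cvg_series_cvg_0 R R^o); apply: nondecreasing_is_cvgn.
    by apply/nondecreasing_seqP => m; rewrite /series /= big_nat_recr//= lerDl sqmod_ge0.
  exists (fine (\sum_(i <oo) (a i x)%:E)%E) => _ [m _ <-].
  rewrite -lee_fin fineK// /series /= -sumEFin.
  by apply: nneseries_lim_ge => i _ _; exact: a0.
(* The value of f on a cell is read at any good point y k of that cell. *)
pose good x := ((fun i => a i x) @ \oo --> (0 : R)) /\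
  forall i k, T (P *m x - ir k) -> g i x = c i k.
have aegood : {ae la, forall x, good x}.
  by apply: filterS2 aeconv (ae_foralln cP) => x; split.
have /choice[y yP] k : exists y, (exists x, good x /\ T (P *m x - ir k)) ->
    good y /\ T (P *m y - ir k).
  have [[x xk]|nx] := pselect (exists x, good x /\ T (P *m x - ir k)).
    by exists x.
  by exists 0.
exists (fun k => f (y k)); apply: filterS aegood => x gx k Tx.
have [[ay gy] Ty] := yP k (ex_intro _ x (conj gx Tx)); have [ax {}gx] := gx.
apply/eqP; rewrite -subr_eq0; apply/eqP; apply: sqmod_eq0.
apply/eqP; rewrite eq_le sqmod_ge0 andbT.
have lim : (fun i => 2 * (a i x + a i (y k))) @ \oo --> (0 : R).
  have -> : (0 : R) = 2 * (0 + 0) by rewrite addr0 mulr0.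
  by apply: cvgMr; exact: cvgD.
apply/ler_addgt0Pr => e e0; rewrite add0r.
have /cvgrPdist_le/(_ e e0)[m _ /(_ m (leqnn m))] := lim.
rewrite /= sub0r normrN => /(le_trans (ler_norm _)); apply: le_trans.
rewrite -[f x - _](subrKA (g m x)) {2}(gx m k)// -(gy m k)//.
by apply: le_trans (sqmodD _ _) _; rewrite /a -[sqmod (g m _ - _)]sqmodN opprB.
Qed.

End tile_space.

(** * The multiresolution analysis *)
Section closure.
Context {R : realType} {n : nat}.
Implicit Types (f g : 'cV[R]_n -> R[i]) (S : set ('cV[R]_n -> R[i])).

Lemma L2closure_sub S : S `<=` L2 -> S `<=` L2closure S.
Proof.
move=> SL2 f Sf; apply/L2closureP; split; first exact: SL2.
move=> e e0; exists f => //; rewrite /energy integral0_eq ?lte_fin// => x _.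
by rewrite subrr sqmod0.
Qed.

Lemma L2closure_closed S : S `<=` L2 -> S (fun=> 0) ->
  (forall c f g, S f -> S g -> S (fun x => c * f x + g x)) ->
  L2closed_subspace (L2closure S).
Proof.
move=> SL2 S0 Slin; have mS f : S f -> measurable_Cfun f.
  by move=> /SL2/L2P[].
have mB f g : L2 f -> L2 g -> measurable_Cfun (fun x => f x - g x).
  by move=> /L2P[mf _] /L2P[mg _]; exact: measurable_CfunB.
split.
- by move=> f [].
- exact: L2closure_sub.
- move=> c f g /L2closureP[L2f fS] /L2closureP[L2g gS].
  apply/L2closureP; split; first exact: L2_lin.
  move=> e e0; have c0 : 0 < sqmod c + 1.
    by rewrite ltr_wpDl// sqmod_ge0.
  (* Each term of [energyD] must be less than e / 4; 1 is added as c may be 0. *)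
  have [f' Sf' ff'] := fS (e / 4 / (sqmod c + 1)) (divr_gt0 (divr_gt0 e0 (ltr0Sn _ 3)) c0).
  have [g' Sg' gg'] := gS (e / 4) (divr_gt0 e0 (ltr0Sn _ 3)).
  exists (fun x => c * f' x + g' x); first exact: Slin.
  have mff := mB _ _ L2f (SL2 _ Sf'); have mgg := mB _ _ L2g (SL2 _ Sg').
  rewrite (_ : (fun x => _) = fun x => c * (f x - f' x) + (g x - g' x)); last first.
    by apply/funext => x; rewrite mulrBr opprD addrACA.
  apply: le_lt_trans (energyD _ mgg) _; first exact: measurable_CfunM.
  rewrite energyZ//; apply: (@le_lt_trans _ _ (2%:E * ((sqmod c)%:E *
      (e / 4 / (sqmod c + 1))%:E + energy (fun x => (g x - g' x)%R)))%E).
    apply: lee_pmul => //.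
      by rewrite adde_ge0 ?mule_ge0 ?energy_ge0 ?lee_fin ?sqmod_ge0.
    by rewrite leeD2r// lee_wpmul2l ?lee_fin ?sqmod_ge0// ltW.
  apply: (@lt_le_trans _ _ (2%:E * ((e / 4)%:E + (e / 4)%:E))%E).
    rewrite lte_pmul2l// -EFinM lee_ltD// lee_fin.
    by rewrite mulrCA ler_piMr ?divr_ge0// ?ltW// ltr_pdivrMr// mul1r ltrDl.
  by rewrite -EFinD -EFinM lee_fin; lra.
- move=> f L2f fS; apply/L2closureP; split=> // e e0.
  have [g /L2closureP[L2g gS] fg] := fS (e / 4) (divr_gt0 e0 (ltr0Sn _ 3)).
  have [h Sh gh] := gS (e / 4) (divr_gt0 e0 (ltr0Sn _ 3)).
  exists h => //.
  have mfg := mB _ _ L2f L2g; have mgh := mB _ _ L2g (SL2 _ Sh).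
  rewrite (_ : (fun x => _) = fun x => (f x - g x) + (g x - h x)); last first.
    by apply/funext => x; rewrite subrKA.
  apply: le_lt_trans (energyD mfg mgh) _.
  apply: (@lt_le_trans _ _ (2%:E * ((e / 4)%:E + (e / 4)%:E))%E).
    by rewrite lte_pmul2l// lteD.
  by rewrite -EFinD -EFinM lee_fin; lra.
Qed.

End closure.

Section mra.
Context {R : realType} {n : nat} (B : 'M[int]_n) (N : 'M[R]_n).
Hypothesis BN : contracting_inverse B N.
Local Notation ir := (int_mx R).
Local Notation M := (int_mx R B).
Notation la := (@lebesgue_cV R n).
Local Notation T := (tile B N).
Implicit Types (f g : 'cV[R]_n -> R[i]).

(** The integer power B^j, with N in the role of B^-1. *)
Definition dilation_pow (j : int) : 'M[R]_n :=
  match j with Posz m => M ^+ m | Negz m => N ^+ m.+1 end.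

Let MN : M * N = 1. Proof. exact: contr_mulmxV BN. Qed.
Let NM : N * M = 1. Proof. exact: contr_mulVmx BN. Qed.

Lemma dilation_powSl j : dilation_pow (j + 1) = M *m dilation_pow j.
Proof.
case: j => [m|[|m]]; first by rewrite -PoszD addn1 /= exprS.
  by rewrite [Negz 0 + 1](_ : _ = 0)//= expr1 expr0; exact/esym/MN.
rewrite (_ : Negz m.+1 + 1 = Negz m) /=; last by rewrite !NegzE; lia.
by rewrite mulmxE [in RHS]exprS mulrA MN mul1r.
Qed.

Lemma dilation_powSr j : dilation_pow (j + 1) = dilation_pow j *m M.
Proof.
case: j => [m|[|m]]; first by rewrite -PoszD addn1 /= exprSr.
  by rewrite [Negz 0 + 1](_ : _ = 0)//= expr1 expr0; exact/esym/NM.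
rewrite (_ : Negz m.+1 + 1 = Negz m) /=; last by rewrite !NegzE; lia.
by rewrite mulmxE [in RHS]exprSr -mulrA NM mulr1.
Qed.

Definition tile_mra (j : int) := tile_space B N (dilation_pow j).

Lemma tile_mra_mono j m : tile_mra j `<=` tile_mra (j + m%:Z).
Proof.
elim: m => [|m IH]; first by rewrite addr0.
apply: subset_trans IH _; rewrite -(addn1 m) PoszD addrA => f.
by move/(tile_space_nested BN); rewrite /tile_mra dilation_powSl.
Qed.

Lemma tile_mra_union_lin c f g : (\bigcup_j tile_mra j) f -> (\bigcup_j tile_mra j) g ->
  (\bigcup_j tile_mra j) (fun x => c * f x + g x).
Proof.
have le_V i j : (i <= j)%R -> tile_mra i `<=` tile_mra j.
  move=> ij; rewrite -(subrKC i j); case: (j - i) (subr_ge0 i j) => [m|m].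
    by move=> _; exact: tile_mra_mono.
  by rewrite ij.
move=> [i _ Vf] [j _ Vg]; exists (Num.max i j) => //.
apply: (L2subspace_lin (tile_space_subspace _ _ _)).
  by apply: le_V Vf; rewrite le_max lexx.
by apply: le_V Vg; rewrite le_max lexx orbT.
Qed.

Lemma sup_ball_expr m c x : sup_ball c x -> sup_ball (c / 4 ^+ m) (N ^+ m *m x).
Proof.
elim: m => [|m IH]; first by rewrite expr0 divr1 mul1mx.
move=> /IH /(contr_sup_ball BN); rewrite [N ^+ m.+1]exprS -mulmxE -mulmxA.
by rewrite exprS invfM [4^-1 * _]mulrC mulrA.
Qed.

(** The union of the cells of level m that are contained in U. *)
Definition tile_inner (U : set 'cV[R]_n) m : set 'cV[R]_n := [set x | exists2 k,
  T (M ^+ m *m x - ir k) & forall y, T (M ^+ m *m y - ir k) -> U y].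

Lemma measurable_tile_inner U m : measurable (tile_inner U m).
Proof.
pose F k : set 'cV[R]_n := if `[< forall y, T (M ^+ m *m y - ir k) -> U y >]
  then [set x | T (M ^+ m *m x - ir k)] else set0.
rewrite (_ : tile_inner U m = \bigcup_k F k); last first.
  apply/seteqP; split=> x.
    by move=> [k Tk kU]; exists k => //; rewrite /F asboolT.
  by move=> [k _]; rewrite /F; case: asboolP => // kU Tk; exists k.
apply: countable_bigcupT_measurable => [|k]; first exact: countableP.
rewrite /F; case: asboolP => // _.
by apply: measurable_setT_preimage (measurable_tile B N); exact: measurable_affine.
Qed.

Lemma dilation_expr_mulV m : M ^+ m *m N ^+ m = 1%:M.
Proof.
elim: m => [|m IH]; first by rewrite mul1mx.
rewrite exprSr exprS mulmxE mulrA -(mulrA _ M N) MN mulr1; exact: IH.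
Qed.

(** The function is the indicator of [tile_inner U m].  It equals 1 on the cells
    contained in U; on any other cell it vanishes off the overlaps of cells. *)
Lemma tile_mra_inner_indicator U (m : nat) : measurable U -> (la U < +oo)%E ->
  tile_mra m%:Z (fun x => cindic (tile_inner U m) x * cindic U x).
Proof.
move=> mU Ufin; split.
  by apply: L2_mask; [exact: measurable_tile_inner|exact: L2_cindic].
exists (fun k => if `[< forall y, T (M ^+ m *m y - ir k) -> U y >] then 1 else 0).
have [Z [mZ Z0 oZ]] := negligible_tile_overlap BN.
have ov : {ae la, forall x, ~ tile_overlap B N x}.
  by exists Z; split=> // x /contrapT; exact: oZ.
apply: filterS (ae_linear (dilation_expr_mulV m) ov) => x nov k Tk.
case: asboolP => [kU|kU].
  by rewrite !cindicT ?mulr1//; [exact: kU|exists k].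
rewrite cindicF ?mul0r// => -[l Tl lU]; apply: nov; exists k, l; split=> //.
by apply: contra_notN kU => /eqP->.
Qed.

(** By [L2closed_dense] it is enough to reach the indicator of a bounded open set
    U.  Two points of the same cell of level m are at distance at most 2 / 4^m, so
    the cell of a point of U is contained in U as soon as m is large. *)
Lemma tile_mra_dense : L2closure (\bigcup_j tile_mra j) = L2.
Proof.
have VL2 : \bigcup_j tile_mra j `<=` L2 by move=> f [j _] [].
apply/seteqP; split; first by move=> f [].
apply: L2closed_dense.
  apply: L2closure_closed => //; last exact: tile_mra_union_lin.
  by exists 0 => //; exact: (L2subspace0 (tile_space_subspace _ _ _)).
move=> U c mU oU Uc; have Ufin := lebesgue_bounded_fin mU Uc.
have L2U := L2_cindic mU Ufin.
apply/L2closureP; split=> // e e0.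
have [|m Hm] := energy_mask_approx L2U (measurable_tile_inner U) _ e0; last first.
  exists (fun x => cindic (tile_inner U m) x * cindic U x) => //.
  by exists m%:Z => //; exact: tile_mra_inner_indicator.
apply: aeW => x; have [Ux|Ux] := pselect (U x); last first.
  by exists 0%N => m _; right; exact: cindicF.
(* From m >= 2 / r follows 2 / 4^m <= r, because m < 4^m. *)
have [r r0 rU] := oU _ Ux; exists (Num.truncn (2 / r)).+1 => m m0; left.
have [k Tk] := tile_cover BN (M ^+ m *m x); exists k => // y Ty; apply: rU.
have -> : y - x = N ^+ m *m (M ^+ m *m y - M ^+ m *m x).
  by rewrite -mulmxBr mulmxA (mulmx1C (dilation_expr_mulV m)) mul1mx.
have : sup_ball (1 + 1) (M ^+ m *m y - M ^+ m *m x).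
  have := sup_ballB (tile_sup_ball Ty) (tile_sup_ball Tk).
  by rewrite opprB addrA subrK.
move/(sup_ball_expr m); apply: sup_ball_le.
rewrite ler_pdivrMr ?exprn_gt0// mulrC -ler_pdivrMr//.
apply: ltW; apply: lt_le_trans (truncnS_gt _) _.
apply: (@le_trans _ _ m%:R); first by rewrite ler_nat.
by rewrite -natrX ler_nat ltnW// ltn_expl.
Qed.

End mra.

Section scaling_function.
Context {R : realType} {n : nat} (B : 'M[int]_n) (N : 'M[R]_n).
Hypothesis BN : contracting_inverse B N.
Local Notation ir := (int_mx R).
Local Notation M := (int_mx R B).
Notation la := (@lebesgue_cV R n).
Local Notation T := (tile B N).
Local Notation V0 := (tile_space B N 1%:M).
Local Notation phi := (cindic T).

Let mT := measurable_tile B N.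

Lemma translate_cindic k : translate k phi = cindic (shift_set T k).
Proof. by apply/funext => x; rewrite /translate /cindic !indicE. Qed.

Lemma ae_tile_overlap : {ae la, forall x, ~ tile_overlap B N x}.
Proof.
have [Z [mZ Z0 oZ]] := negligible_tile_overlap BN.
by exists Z; split=> // x /contrapT; exact: oZ.
Qed.

Lemma translate_tile_mem k : V0 (translate k phi).
Proof.
rewrite translate_cindic; split.
  apply: L2_cindic; first exact: measurable_shift_set.
  by rewrite lebesgue_shift_set// (lebesgue_tile BN) ltry.
exists (fun l => (l == k)%:R); apply: filterS ae_tile_overlap => x ov l.
rewrite mul1mx => Tl; case: eqVneq Tl => [->|lk] Tl; first by rewrite cindicT.
by rewrite cindicF// => Tk; apply: ov; exists l, k.
Qed.

Lemma inner_translate_tile k l :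
  inner (translate k phi) (translate l phi) = (k == l)%:R.
Proof.
have mkl : measurable (shift_set T k `&` shift_set T l).
  by apply: measurableI; exact: measurable_shift_set.
rewrite !translate_cindic /inner.
have hE x : cindic (shift_set T k) x * ((cindic (shift_set T l) x)^*)%C =
    ((\1_(shift_set T k `&` shift_set T l) x : R)%:C)%C.
  rewrite /cindic conjc_real -rmorphM/= !indicE in_setI -natrM mulnb.
  by [].
under eq_Rintegral do rewrite hE /=.
under [X in Complex _ X]eq_Rintegral do rewrite hE /=.
have -> : (\int[la]_x (\1_(shift_set T k `&` shift_set T l) x : R))%R = (k == l)%:R.
  transitivity (fine (la (shift_set T k `&` shift_set T l))).
    by rewrite /Rintegral integral_indic// setIT.
  have [->|kl] := eqVneq k l.
    by rewrite setIid lebesgue_shift_set// (lebesgue_tile BN).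
  have /negligibleP : la.-negligible (shift_set T k `&` shift_set T l).
    apply: negligibleS (negligible_tile_overlap BN) => x [Tk Tl].
    by exists k, l.
  by move=> /(_ mkl) kl0; rewrite [la _]kl0.
rewrite Rintegral_cst// mul0r.
by case: (k == l).
Qed.

(** Cut f off to the translates of the tile indexed by a finite box: off the
    overlaps this is a finite combination of translates of the indicator.  The
    converse is [tile_space_closed]. *)
Lemma tile_space_closed_span : V0 = L2closure (lin_span (fun k => translate k phi)).
Proof.
have sub := tile_space_subspace B N 1%:M.
have span (s : seq 'cV[int]_n) (c : 'cV[int]_n -> R[i]) :
    V0 (fun x => \sum_(k <- s) c k * translate k phi x).
  elim: s => [|k s IH].
    by under eq_fun do rewrite big_nil; exact: (L2subspace0 sub).
  under eq_fun do rewrite big_cons.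
  exact: (L2subspace_lin sub _ (translate_tile_mem k) IH).
apply/seteqP; split=> f; last first.
  move=> /L2closureP[L2f app]; apply: tile_space_closed => // e e0.
  have [_ [s [c ->]] eg] := app e e0.
  by exists (fun x => \sum_(k <- s) c k * translate k phi x).
move=> [L2f [c fc]]; have [mf _] := (L2P f).1 L2f; apply/L2closureP; split => // e e0.
have mA m := measurable_translates (int_box m) mT.
have [|m Hm] := energy_mask_approx L2f mA _ e0.
  apply: aeW => x; have [k Tk] := tile_cover BN x.
  exists (\sum_i absz (k i ord0))%N => m km; left; exists k => //.
  apply: mem_int_box => i; rewrite -abszE lez_nat; apply: leq_trans km.
  by rewrite (bigD1 i)//= leq_addr.
exists (fun x => \sum_(k <- undup (int_box m)) c k * translate k phi x).
  by exists (undup (int_box m)), c.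
rewrite (eq_energy_ae (g := fun x => f x - cindic (translates T (int_box m)) x * f x))//.
- by apply: measurable_CfunB; [exact: mf|have [/L2P[]] := span (undup (int_box m)) c].
- by apply: measurable_CfunB => //; apply: measurable_CfunM => //; exact: measurable_cindic.
apply: filterS2 ae_tile_overlap fc => x ov fx; congr (_ - _).
have [k Tk] := tile_cover BN x.
have Tl l : translate l phi x = (l == k)%:R.
  rewrite translate_cindic; case: eqVneq => [->|lk]; first by rewrite cindicT.
  by rewrite cindicF// => Tlx; apply: ov; exists l, k.
under eq_bigr do rewrite Tl.
rewrite (fx k) ?mul1mx//; have [km|km] := boolP (k \in int_box m).
  rewrite cindicT ?mul1r; last by exists k.
  rewrite (bigD1_seq k) ?mem_undup ?undup_uniq//= eqxx mulr1 big1 ?addr0// => l lk.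
  by rewrite (negbTE lk) mulr0.
rewrite cindicF ?mul0r; last first.
  move=> [l lm Tlx]; have [lk|lk] := eqVneq l k; first by move: km; rewrite -lk lm.
  by apply: ov; exists l, k.
rewrite big_seq big1// => l; rewrite mem_undup => lm.
by case: eqVneq lm km => [->->//|_ _ _]; rewrite mulr0.
Qed.

End scaling_function.

(** In positive dimension the cells at least double in measure from one level to
    the next coarser one, which makes the intersection trivial. *)
Theorem tile_mra_multiresolution (R : realType) (n : nat) (B : 'M[int]_n) (N : 'M[R]_n) :
  (0 < n)%N -> dilation_matrix R B -> contracting_inverse B N ->
  multiresolution_analysis B (tile_mra B N).
Proof.
move=> n0 dB BN; split => //.
- by move=> j; exact: tile_space_subspace.
- by move=> j; exact: (@tile_mra_mono _ _ _ _ BN j 1%N).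
- exact: tile_mra_dense.
- apply/seteqP; split=> f.
    move=> Vf; have V0 := Vf 0 I; split; first by have [] := V0.
    apply: (tile_space_bigcap0 BN n0) => -[|m]; first exact: V0.
    exact: (Vf (Negz m) I).
  move=> [L2f f0] j _; have sub := tile_space_subspace B N (dilation_pow B N j).
  apply: (L2subspace_ae sub (L2subspace0 sub) L2f).
  by apply: filterS f0 => x ->.
- move=> j f L2f; rewrite /tile_mra dilation_powSr//; exact: tile_space_dilate.
- by move=> k f L2f; exact: tile_space_translate.
- exists (cindic (tile B N)).
    have := translate_tile_mem BN 0; rewrite translate_cindic.
    rewrite (_ : shift_set _ 0 = tile B N)//.
    by apply/seteqP; split=> x; rewrite /shift_set /= int_mx0 subr0.
  split; [exact: translate_tile_mem|exact: inner_translate_tile|exact: tile_space_closed_span].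
Qed.

Unset Implicit Arguments.

Theorem theorem14 (R : realType) (n : nat) (A : 'M[int]_n) :
  (0 < n)%N -> dilation_matrix R A ->
  exists2 beta : nat, (1 <= beta)%N &
    forall k : nat, (beta <= k)%N ->
      exists V : int -> set ('cV[R]_n -> R[i]),
        multiresolution_analysis (A ^+ k) V.
Proof.
move=> n0 dA; have [beta b1 H] := dilation_power_contracting n0 dA.
exists beta => // k /H[dAk [N AkN]].
by exists (tile_mra (A ^+ k) N); exact: tile_mra_multiresolution.
Qed.
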